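(* There exists an $O(\log n)$-competitive deterministic online algorithm for edge-weighted Steiner forest with deadlines which runs in polynomial time, where $n$ is the number of vertices of the input graph.
   Context: Edge-weighted Steiner forest with deadlines: given in advance a simple undirected graph $G=(V,E)$ with $|V|=n$ and edge costs $c:E\to\mathbb{R}^+$. Requests arrive over time; each request $q$ is a pair of vertices $(u_1,u_2)$, released at time $r_q$ with a deadline $d_q$ revealed at release. At any time the algorithm may transmit an edge set $E'\subseteq E$ at cost $\sum_{e\in E'}c(e)$; this serves every pending request $(u_1,u_2)$ such that $u_1,u_2$ lie in the same connected component of $(V,E')$. Each request must be served at some time in $[r_q,d_q]$. The cost is the total transmission cost. An online algorithm is $\alpha$-competitive if on every input its cost is at most $\alpha$ times the optimal offline cost. *)

(* Defs.v *)
From HB Require Import structures.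
From mathcomp Require Import all_boot all_order all_algebra.
From mathcomp Require Import all_classical all_reals all_analysis.
Set Implicit Arguments.
Unset Strict Implicit.
Unset Printing Implicit Defensive.
Import Order.TTheory GRing.Theory Num.Theory.
Local Open Scope ring_scope.

(** * Edge-weighted Steiner forest with deadlines *)

(* A simple graph on the vertices 0, ..., n-1; an edge is a two-element set of
   vertices.  The values of [ecost] outside [edges] are irrelevant. *)
Record wgraph (R : realType) (n : nat) := WGraph {
  edges : {set {set 'I_n}};
  ecost : {set 'I_n} -> R;
  edges_card2 : forall e, e \in edges -> #|e| = 2%N;
  ecost_gt0 : forall e, e \in edges -> 0 < ecost e }.

Definition edge_rel n (E : {set {set 'I_n}}) : rel 'I_n :=
  [rel x y | [set x; y] \in E].

(* ((u1, u2), (release time, deadline)) *)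
Definition request (R : realType) (n : nat) : Type :=
  (('I_n * 'I_n) * (R * R))%type.

Section Requests.
Variables (R : realType) (n : nat).
Implicit Types (G : wgraph R n) (q : request R n).

Definition endpoint1 q : 'I_n := q.1.1.
Definition endpoint2 q : 'I_n := q.1.2.
Definition release q : R := q.2.1.
Definition deadline q : R := q.2.2.

(* An input is the sequence of requests in order of arrival.  The last
   condition says that the request can be served at all. *)
Definition valid_input G (Q : seq (request R n)) : bool :=
  sorted (fun q q' => release q <= release q') Q &&
  all (fun q => (release q <= deadline q) &&
         connect (edge_rel (edges G)) (endpoint1 q) (endpoint2 q)) Q.

(* The transmissions (time, edge set) *)
Definition schedule : Type := seq (R * {set {set 'I_n}}).

Definition serves (x : R * {set {set 'I_n}}) q : bool :=
  (release q <= x.1 <= deadline q) &&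
  connect (edge_rel x.2) (endpoint1 q) (endpoint2 q).

Definition feasible G (Q : seq (request R n)) (S : schedule) : bool :=
  all (fun x : R * {set {set 'I_n}} => x.2 \subset edges G) S && all (fun q => has (serves^~ q) S) Q.

Definition cost G (S : schedule) : R :=
  \sum_(x <- S) \sum_(e in x.2) ecost G e.

Definition opt G (Q : seq (request R n)) : R :=
  inf [set cost G S | S in [set S : schedule | feasible G Q S]]%classic.

End Requests.

(** * Deterministic online algorithms *)

(* The map from inputs to produced schedules of a deterministic algorithm *)
Definition algorithm (R : realType) : Type :=
  forall n, wgraph R n -> seq (request R n) -> schedule R n.

(* What is transmitted up to time t is determined by the graph and by the
   requests released up to time t. *)
Definition online (R : realType) (A : algorithm R) : Prop :=
  forall n (G : wgraph R n) (Q Q' : seq (request R n)) (t : R),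
    valid_input G Q -> valid_input G Q' ->
    [seq q <- Q | release q <= t] = [seq q <- Q' | release q <= t] ->
    [seq x <- A n G Q | x.1 <= t] = [seq x <- A n G Q' | x.1 <= t].

Definition competitive (R : realType) (A : algorithm R) (alpha : nat -> R)
    : Prop :=
  forall n (G : wgraph R n) (Q : seq (request R n)), valid_input G Q ->
    feasible G Q (A n G Q) /\ cost G (A n G Q) <= alpha n * opt G Q.

(** * Computation *)

(* Since costs and times are real numbers, programs run on a real RAM: a WHILE
   language on binary trees with real leaves, in which reading or storing a
   number, a comparison and an arithmetic operation take unit time.  Pairing
   and projections are pointer operations, hence unit time as well.
   The arithmetic operations are only x + y, x - y and x / 2: with these, T
   steps on rational data lengthen the binary representations by O(T) bits
   only, so that unit cost and bit cost are polynomially related.  (This could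
   fail with multiplication, because of repeated squaring.) *)
Inductive value (R : Type) : Type :=
| Nil
| Leaf of R
| Pair of value R & value R.
Arguments Nil {R}.

Inductive expr : Type :=
| Var of nat
| ENil
| EOne
| EPair of expr & expr
| EFst of expr
| ESnd of expr
| EAdd of expr & expr
| ESub of expr & expr
| EHalf of expr
| ELe of expr & expr.

Inductive cmd : Type :=
| Skip
| Assign of nat & expr
| Seq of cmd & cmd
| If of expr & cmd & cmd
| While of expr & cmd.

Section Semantics.
Variable R : realType.

Definition store := nat -> value R.

(* [Nil] stands for false and everything else for true; ill-typed operations
   return [Nil]. *)
Definition truthy (v : value R) : bool := if v is Nil then false else true.

Definition of_bool (b : bool) : value R := if b then Pair Nil Nil else Nil.

Fixpoint eval (s : store) (a : expr) : value R :=
  match a with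
  | Var x => s x
  | ENil => Nil
  | EOne => Leaf 1
  | EPair a1 a2 => Pair (eval s a1) (eval s a2)
  | EFst a1 => if eval s a1 is Pair v _ then v else Nil
  | ESnd a1 => if eval s a1 is Pair _ v then v else Nil
  | EAdd a1 a2 =>
      if (eval s a1, eval s a2) is (Leaf x, Leaf y) then Leaf (x + y) else Nil
  | ESub a1 a2 =>
      if (eval s a1, eval s a2) is (Leaf x, Leaf y) then Leaf (x - y) else Nil
  | EHalf a1 => if eval s a1 is Leaf x then Leaf (x / 2) else Nil
  | ELe a1 a2 =>
      if (eval s a1, eval s a2) is (Leaf x, Leaf y) then of_bool (x <= y) else Nil
  end.

Fixpoint eval_time (a : expr) : nat :=
  match a with
  | Var _ | ENil | EOne => 1
  | EFst a1 | ESnd a1 | EHalf a1 => (eval_time a1).+1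
  | EPair a1 a2 | EAdd a1 a2 | ESub a1 a2 | ELe a1 a2 =>
      (eval_time a1 + eval_time a2).+1
  end.

Definition update (s : store) (x : nat) (v : value R) : store :=
  fun y => if y == x then v else s y.

(* [exec c s T s']: started in s, the command c halts in s' after T steps. *)
Inductive exec : cmd -> store -> nat -> store -> Prop :=
| exec_skip s : exec Skip s 1 s
| exec_assign s x a :
    exec (Assign x a) s (eval_time a).+1 (update s x (eval s a))
| exec_seq s s1 s2 T1 T2 c1 c2 :
    exec c1 s T1 s1 -> exec c2 s1 T2 s2 -> exec (Seq c1 c2) s (T1 + T2) s2
| exec_if s s' T a c1 c2 :
    exec (if truthy (eval s a) then c1 else c2) s T s' ->
    exec (If a c1 c2) s (eval_time a + T).+1 s'
| exec_while_stop s a c :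
    ~~ truthy (eval s a) -> exec (While a c) s (eval_time a).+1 s
| exec_while_step s s1 s2 T1 T2 a c :
    truthy (eval s a) -> exec c s T1 s1 -> exec (While a c) s1 T2 s2 ->
    exec (While a c) s (eval_time a + T1 + T2).+1 s2.

(* Input and output are held in variable 0; all other variables start as
   [Nil]. *)
Definition computes (P : cmd) (v : value R) (T : nat) (w : value R) : Prop :=
  exists2 s, exec P (update (fun=> Nil) 0 v) T s & s 0 = w.

Fixpoint enc_list (vs : seq (value R)) : value R :=
  if vs is v :: vs' then Pair v (enc_list vs') else Nil.

Definition enc_vertex n (u : 'I_n) : value R := Leaf u%:R.

Definition enc_pair n (p : 'I_n * 'I_n) : value R :=
  Pair (enc_vertex p.1) (enc_vertex p.2).

Definition enc_graph n (G : wgraph R n) : value R :=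
  Pair (Leaf n%:R)
    (enc_list
      [seq Pair (enc_pair p) (Leaf (ecost G [set p.1; p.2]))
        | p : 'I_n * 'I_n <- enum {: 'I_n * 'I_n}
        & (p.1 < p.2)%N && ([set p.1; p.2] \in edges G)]).

Definition enc_request n (q : request R n) : value R :=
  Pair (enc_pair q.1) (Pair (Leaf (release q)) (Leaf (deadline q))).

Definition enc_input n (G : wgraph R n) (Q : seq (request R n)) : value R :=
  Pair (enc_graph G) (enc_list [seq enc_request q | q <- Q]).

(* Programs output edge sets as lists of edges. *)
Definition enc_output n (o : seq (R * seq ('I_n * 'I_n))) : value R :=
  enc_list [seq Pair (Leaf x.1) (enc_list [seq enc_pair p | p <- x.2]) | x <- o].

Definition output_schedule n (o : seq (R * seq ('I_n * 'I_n)))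
    : schedule R n :=
  [seq (x.1, [set:: [seq [set p.1; p.2] | p <- x.2]]) | x <- o].

(* A single program computes the schedule, for all n, in time polynomial in
   n + the number of requests.  For an online A, the transmissions up to the
   next release are those obtained from the requests released so far, hence
   this bounds the time spent at each release. *)
Definition polytime (A : algorithm R) : Prop :=
  exists (P : cmd) (p : {poly nat}),
  forall n (G : wgraph R n) (Q : seq (request R n)), valid_input G Q ->
  exists (T : nat) (o : seq (R * seq ('I_n * 'I_n))),
    [/\ computes P (enc_input G Q) T (enc_output o),
        A n G Q = output_schedule o
      & (T <= p.[n + size Q])%N].

End Semantics.

(* Main.v *)
Require Import Defs.
From mathcomp Require Import all_boot all_order all_algebra.
From mathcomp Require Import all_classical all_reals all_analysis.
From mathcomp Require Import lra zify.
Set Implicit Arguments.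
Unset Strict Implicit.
Unset Printing Implicit Defensive.
Import Order.TTheory GRing.Theory Num.Theory.
Local Open Scope ring_scope.

(* Each pending request has a level, initially the cost of an approximately
   optimal connection of its endpoints.  When a deadline is reached, the level L
   of that request is the budget of a service: in the order of their deadlines,
   the pending requests of level at most 2L are included as long as a
   2-approximate Steiner forest for all of them costs at most 2L, where edges of
   cost at most L/(4m) are free, m being the number of edges; those left out are
   raised to level 2L.  The approximation is the primal-dual one of Goemans and
   Williamson.

   Every service has a witness: a set of requests whose deadlines have passed at
   that time and which cost any solution at least L/4, even if edges of cost at
   most L/(8m) are free and the others count at most L each.  It is the request
   itself or the set whose approximate Steiner forest was too expensive when the
   request was last raised.  The requests pending at an earlier service of level
   L' now have level at least 2L', hence the witness is released after that
   service unless L >= 2L'.  So the services to whose lower bounds a given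
   transmission of an optimal schedule contributes at least double their level
   from one to the next, and only O(log m) of them charge a given edge. *)

(** * Connectivity *)

(** Requests are tried in the order of deadlines because a request left out is blamed on itself
    together with those already included: their deadlines are no later than its own, so this witness
    has expired whenever that request triggers a service. The budget [2L] rather than [L] absorbs
    the loss of the approximation, so that the triggering request always fits. Both truncations in
    the lower bound serve the charging. A service of level [L] charges an edge of cost [c] at most
    [min(c, L)], and only if [L < 8mc]. Among doubling levels, those up to [c] form a geometric
    series of sum at most [2c], and only about [log2(8m)] lie between [c] and [8mc]. The free edges
    add [L/4] to a service, which thus costs at most [9L/4]; against the lower bound [L/4] this
    gives the factor [9 (log2(8m) + 2)], and [m <= n^2]. The machine has no multiplication and
    divides by 2 only. Hence the threshold [L/(4m)] is tested by repeated addition, and all loops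
    are folds over lists of controlled length, which a small compiler can translate. *)

Lemma connect_hom (T T' : finType) (r : rel T) (r' : rel T') (f : T -> T') :
  (forall x y, r x y -> connect r' (f x) (f y)) ->
  forall x y, connect r x y -> connect r' (f x) (f y).
Proof.
move=> hom x y /connectP[p + ->]; elim: p x => [|z p IH] x //= /andP[rxz pz].
exact: connect_trans (hom _ _ rxz) (IH _ pz).
Qed.

Lemma connect_exit (T : finType) (r : rel T) (P : pred T) x y :
  connect r x y -> P x -> ~~ P y -> exists u v, [/\ r u v, P u & ~~ P v].
Proof.
move=> /connectP[p + ->]; elim: p x => [|z p IH] x /=.
  by move=> _ ->.
move=> /andP[rxz pz] Px; case Pz: (P z); first exact: IH.
by move=> _; exists x, z; rewrite Pz.
Qed.

Section EdgeSets.
Variable n : nat.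
Local Notation V := 'I_n.
Implicit Types (X : {set {set V}}) (ps : seq (V * V)) (p : V * V).

Definition pedge p : {set V} := [set p.1; p.2].

Lemma pedge_eq p x y : pedge p = [set x; y] ->
  (p.1 = x /\ p.2 = y) \/ (p.1 = y /\ p.2 = x).
Proof.
case: p => u v; rewrite /pedge /= => E.
have: u \in [set x; y] by rewrite -E !inE eqxx.
have: v \in [set x; y] by rewrite -E !inE eqxx orbT.
have: x \in [set u; v] by rewrite E !inE eqxx.
have: y \in [set u; v] by rewrite E !inE eqxx orbT.
rewrite !inE => /orP[] /eqP -> /orP[] /eqP -> ; try (by auto);
 by move=> /orP[] /eqP ? /orP[] /eqP ?; subst; auto.
Qed.

Lemma edge_rel_sym X : symmetric (edge_rel X).
Proof. by move=> x y; rewrite /edge_rel /= finset.setUC. Qed.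

Lemma edge_connect_sym X x y :
  connect (edge_rel X) x y = connect (edge_rel X) y x.
Proof. exact: (sym_connect_sym (edge_rel_sym X)). Qed.

Definition connects X ps : bool :=
  all (fun p => connect (edge_rel X) p.1 p.2) ps.

Lemma connectsP X ps :
  reflect (forall p, p \in ps -> connect (edge_rel X) p.1 p.2) (connects X ps).
Proof. exact: allP. Qed.

Lemma edge_connect_sub X X' x y :
  X \subset X' -> connect (edge_rel X) x y -> connect (edge_rel X') x y.
Proof.
move=> sX; apply: (@connect_hom _ _ _ _ id) => u v uv.
by apply: connect1; apply: (fintype.subsetP sX).
Qed.

Lemma connects_sub X X' ps : X \subset X' -> connects X ps -> connects X' ps.
Proof. by move=> sX; apply: sub_all => p; apply: edge_connect_sub. Qed.

Definition lset (es : seq (V * V)) : {set {set V}} := [set:: map pedge es].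

Lemma in_lset es e : (e \in lset es) = (e \in map pedge es).
Proof. by rewrite /lset finset.inE. Qed.

Lemma lset_rel es x y : edge_rel (lset es) x y ->
  exists2 p, p \in es & (p.1 = x /\ p.2 = y) \/ (p.1 = y /\ p.2 = x).
Proof.
rewrite /edge_rel /= in_lset => /mapP[p pes E].
by exists p => //; apply: pedge_eq.
Qed.

Lemma connect_lset es p : p \in es -> connect (edge_rel (lset es)) p.1 p.2.
Proof.
by move=> pes; apply: connect1; rewrite /edge_rel /= in_lset; apply: map_f.
Qed.

Definition relab (a b x : V) := if x == a then b else x.
Definition relab2 a b p := (relab a b p.1, relab a b p.2).

Definition cstep (st : seq (V * V) * seq (V * V)) : seq (V * V) * seq (V * V) :=
  if st.1 is p :: es then
    (map (relab2 p.1 p.2) es, map (relab2 p.1 p.2) st.2)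
  else st.

(** Connectivity by successive contraction of the edges. This form is a fold of [map]s, which a
    machine program can follow literally. *)
Definition conn (es ps : seq (V * V)) : bool :=
  all (fun p => p.1 == p.2) (foldl (fun st _ => cstep st) (es, ps) es).2.

(** Contraction of the edge [(a, b)] is a homomorphism; conversely a contracted edge lifts to a
    path, since [(a, b)] joins every vertex to its new label. *)
Lemma connect_relab a b es x y :
  connect (edge_rel (lset ((a, b) :: es))) x y =
  connect (edge_rel (lset (map (relab2 a b) es))) (relab a b x) (relab a b y).
Proof.
have to_relab z : connect (edge_rel (lset ((a, b) :: es))) z (relab a b z).
  rewrite /relab; case: eqP => [->|_]; last exact: connect0.
  by apply: (@connect_lset _ (a, b)); rewrite inE eqxx.
apply/idP/idP => [|H].
  apply: (@connect_hom _ _ _ _ (relab a b)) => u v /lset_rel[p].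
  rewrite inE => /predU1P[-> /= uv|pes uv].
    by case: uv => -[<- <-]; rewrite /relab !eqxx; case: ifP => // /eqP->.
  have := connect_lset (map_f (relab2 a b) pes).
  by case: uv => -[<- <-] //=; rewrite edge_connect_sym.
apply: connect_trans (to_relab x) _.
rewrite edge_connect_sym; apply: connect_trans (to_relab y) _.
rewrite edge_connect_sym; apply: (@connect_hom _ _ _ _ id) H => {}x {}y.
move=> /lset_rel[_ /mapP[p pes ->]] xy.
have pe : p \in (a, b) :: es by rewrite inE pes orbT.
have := connect_lset pe => cp.
have H : connect (edge_rel (lset ((a, b) :: es))) (relab a b p.1) (relab a b p.2).
  have := connect_trans cp (to_relab p.2); apply: connect_trans.
  by rewrite edge_connect_sym to_relab.
by case: xy => -[<- <-] //; rewrite edge_connect_sym.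
Qed.

Lemma connE es ps : conn es ps = connects (lset es) ps.
Proof.
rewrite /conn.
have -> l st : foldl (fun st (_ : V * V) => cstep st) st l = iter (size l) cstep st.
  by elim: l st => //= p l IH st; rewrite IH -iterSr.
(* Generalised to any number of steps that is at least [size es]: steps on an empty list change
   nothing. *)
move: (leqnn (size es)); move: {2 3}(size es) => k.
elim: k es ps => [|k IH] es ps.
  case: es => //= _; apply: eq_all => p.
  apply/eqP/idP => [->|]; first exact: connect0.
  by case/connectP => -[|z q] /= => [_ ->|/andP[]] //; rewrite /edge_rel /= in_lset.
rewrite iterSr; case: es => [_|[a b] es /=].
  by rewrite /cstep /= IH.
rewrite ltnS => le; rewrite /cstep /= IH ?size_map //.
rewrite /connects all_map; apply: eq_all => p /=.
by rewrite -connect_relab.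
Qed.

End EdgeSets.

(** * The primal-dual algorithm *)

Section GoemansWilliamson.
Variables (R : realFieldType) (n : nat).
Local Notation V := 'I_n.

Definition wedge : Type := ((V * V) * R)%type.

(* An edge, its slack (cost minus dual load) and the labels of the current
   components of its endpoints *)
Definition erec : Type := (wedge * (R * (V * V)))%type.

Implicit Types (ps : seq (V * V)) (w : wedge) (lab : V -> V) (sl : wedge -> R).

Definition wpe w : {set V} := pedge w.1.

(** Here [ps] consists of pairs of component labels: a component is active if it separates some pair
    that is still to be connected. *)
Definition act ps (l : V) : bool :=
  has (fun p => (p.1 != p.2) && ((p.1 == l) || (p.2 == l))) ps.

Definition flags ps (q : V * V) : bool * bool :=
  if q.1 == q.2 then (false, false) else (act ps q.1, act ps q.2).

Definition annot ps (es : seq erec) : seq (erec * (bool * bool)) :=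
  [seq (e, flags ps e.2.2) | e <- es].

(** An edge between two active components loses slack at double speed. This halving is the only
    division in the growth of the duals. *)
Definition tight_time (a : erec * (bool * bool)) : R :=
  if a.2.1 && a.2.2 then a.1.2.1 / 2 else a.1.2.1.

Definition best (acc : option (R * erec)) (a : erec * (bool * bool)) :=
  if a.2.1 || a.2.2 then
    if acc is Some b then
      if b.1 <= tight_time a then acc else Some (tight_time a, a.1)
    else Some (tight_time a, a.1)
  else acc.

Definition gwupd (d : R) (q : V * V) (a : erec * (bool * bool)) : erec :=
  (a.1.1, (a.1.2.1 - (if a.2.1 then d else 0) - (if a.2.2 then d else 0),
           relab2 q.1 q.2 a.1.2.2)).

Definition gwstate : Type := (seq erec * (seq (V * V) * seq wedge))%type.

Definition gwstep (st : gwstate) : gwstate :=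
  let l := annot st.2.1 st.1 in
  if foldl best None l is Some b then
    (map (gwupd b.1 b.2.2.2) l,
     (map (relab2 b.2.2.2.1 b.2.2.2.2) st.2.1, b.2.1 :: st.2.2))
  else st.

Lemma foldl_best acc l :
  match foldl best acc l with
  | None => acc = None /\ (forall a, a \in l -> ~~ (a.2.1 || a.2.2))
  | Some b =>
    [/\ acc = Some b \/ (exists2 a, a \in l &
          a.2.1 || a.2.2 /\ b = (tight_time a, a.1)),
        (forall a, a \in l -> a.2.1 || a.2.2 -> b.1 <= tight_time a)
      & (forall b0, acc = Some b0 -> b.1 <= b0.1)]
  end.
Proof.
elim: l acc => [|a l IH] acc /=.
  case: acc => [b|] //; split=> //; first by left.
  by move=> b0 [->].
have := IH (best acc a); case E: (foldl _ _ _) => [b|].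
  case=> H1 H2 H3; split.
  - case: H1 => [H1|[a' a'l Ha']]; last first.
      by right; exists a'; rewrite // inE a'l orbT.
    move: H1; rewrite /best; case: ifP => Ha; last by left.
    case: acc {E H2 H3} => [b0|]; last first.
      move=> [<-]; right; exists a; first by rewrite inE eqxx.
      by [].
    case: ifP => _ [<-]; first by left.
    right; exists a; first by rewrite inE eqxx.
    by [].
  - move=> a'; rewrite inE => /predU1P[->|a'l] Ha'; last exact: H2.
    move: H3; rewrite /best Ha'; case: acc {E H1} => [b0|].
      case: ifP => le H3; last by have := H3 _ erefl.
      by apply: le_trans (H3 _ erefl) le.
    by move=> H3; have := H3 _ erefl.
  - move=> b0 eb0; move: H3; rewrite eb0 /best; case: ifP => Ha H3.
      move: H3; case: ifP => le H3; first exact: H3.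
      apply: le_trans (H3 _ erefl) _ => /=.
      by apply: ltW; rewrite ltNge le.
    exact: H3.
rewrite /best; case=> + H; case: ifP => Ha.
  by case: acc {E} => [b|] //; case: ifP.
move=> ->; split=> // a'; rewrite inE => /predU1P[->|]; last exact: H.
by rewrite Ha.
Qed.

Definition labs lab ps := [seq (lab p.1, lab p.2) | p <- ps].

Definition rep (gE : seq wedge) lab sl : seq erec :=
  [seq (w, (sl w, (lab w.1.1, lab w.1.2))) | w <- gE].

Definition wflags ps lab w := flags (labs lab ps) (lab w.1.1, lab w.1.2).
Definition wrate ps lab w : nat := (wflags ps lab w).1 + (wflags ps lab w).2.

Definition merge_lab lab w := relab (lab w.1.1) (lab w.1.2) \o lab.

(** Translates the list manipulation into functions [lab] and [sl]: all active duals grow by [d], up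
    to the first moment at which an edge [w0] becomes tight, and the components at its ends are
    merged. *)
Lemma gwstepP gE ps lab sl F :
  let st := (rep gE lab sl, (labs lab ps, F)) in
  ((forall w, w \in gE -> wrate ps lab w = 0%N) /\ gwstep st = st) \/
  exists w0 d,
    [/\ w0 \in gE, (0 < wrate ps lab w0)%N, d * (wrate ps lab w0)%:R = sl w0,
        (forall w, w \in gE -> (0 < wrate ps lab w)%N ->
           d * (wrate ps lab w)%:R <= sl w)
      & gwstep st =
        (rep gE (merge_lab lab w0) (fun w => sl w - d * (wrate ps lab w)%:R),
         (labs (merge_lab lab w0) ps, w0 :: F))].
Proof.
set st := (rep gE lab sl, (labs lab ps, F)) => /=.
have Eannot : annot (labs lab ps) (rep gE lab sl) =
   [seq ((w, (sl w, (lab w.1.1, lab w.1.2))), wflags ps lab w) | w <- gE].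
  by rewrite /annot /rep -map_comp.
have rateP w : ((wflags ps lab w).1 || (wflags ps lab w).2)
   = (0 < wrate ps lab w)%N.
  by rewrite /wrate; case: (wflags _ _ _) => [[] []].
have tt w (b := ((w, (sl w, (lab w.1.1, lab w.1.2))), wflags ps lab w)) :
    (0 < wrate ps lab w)%N -> tight_time b * (wrate ps lab w)%:R = sl w.
  rewrite /b /tight_time /wrate /=; case: (wflags _ _ _) => [[] []] //= _.
  - by rewrite -mulrA mulVf ?mulr1 // pnatr_eq0.
  - by rewrite mulr1.
  - by rewrite mulr1.
rewrite /gwstep /= Eannot.
have := foldl_best None [seq ((w, (sl w, (lab w.1.1, lab w.1.2))), wflags ps lab w) | w <- gE].
case: (foldl _ _ _) => [b|]; last first.
  case=> _ H; left; split=> // w wg.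
  have := H _ (map_f _ wg); rewrite /= rateP lt0n negbK; exact/eqP.
case=> -[//|[a /mapP[w0 w0g ->] [/= Ha ->]]] H _; right.
exists w0, (tight_time ((w0, (sl w0, (lab w0.1.1, lab w0.1.2))), wflags ps lab w0)).
rewrite rateP in Ha; split=> //.
- exact: tt.
- move=> w wg Hw; rewrite -[leRHS](tt _ Hw) ler_wpM2r ?ler0n //.
  have := H _ (map_f _ wg); rewrite /= rateP Hw; exact.
- rewrite /= -map_comp; congr (_, (_, _)).
    apply: eq_map => w; rewrite /gwupd /=; congr (_, (_, _)).
    rewrite /wrate; case: (wflags ps lab w) => [[] []] /=;
      by rewrite ?subr0 ?mulr1 ?mulr0 ?subr0 // mulr_natr opprD addrA.
  by rewrite /labs -map_comp; apply: eq_map.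
Qed.

Variables (gE : seq wedge) (ps0 : seq (V * V)).
Hypothesis uniq_gE : uniq (map wpe gE).
Implicit Types (X : {set {set V}}) (H : seq wedge) (b : V).

Definition all_edges : {set {set V}} := [set:: map wpe gE].
Hypothesis conn_gE : connects all_edges ps0.

Definition minimal X :=
  connects X ps0 /\ (forall e, e \in X -> ~~ connects (X :\ e) ps0).

Definition active lab := [set b | act (labs lab ps0) b].
Definition crosses lab w := lab w.1.1 != lab w.1.2.
Definition touch lab b w : nat := (lab w.1.1 == b) + (lab w.1.2 == b).

Local Notation rate := (wrate ps0).

Lemma rateE lab w : rate lab w =
  (crosses lab w * ((lab w.1.1 \in active lab) + (lab w.1.2 \in active lab)))%N.
Proof.
rewrite /wrate /wflags /flags /crosses /= !inE.
by case: (_ == _); rewrite ?mul0n ?mul1n.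
Qed.

Lemma sum_eq_mem (A : {set V}) x : (\sum_(b in A) (x == b : nat) = (x \in A))%N.
Proof.
case: (boolP (x \in A)) => xA.
  rewrite (bigD1 x) //= eqxx big1 // => b /andP[_ nb].
  by rewrite eq_sym (negbTE nb).
by rewrite big1 // => b bA; case: eqP => // xb; rewrite xb bA in xA.
Qed.

Lemma wpe_inj w w' : w \in gE -> w' \in gE -> wpe w = wpe w' -> w = w'.
Proof.
elim: gE uniq_gE => //= v l IH /andP[nv ul]; rewrite !inE.
move=> /predU1P[->|wl] /predU1P[->|wl'] // E.
- by case/negP: nv; rewrite E map_f.
- by case/negP: nv; rewrite -E map_f.
- exact: IH.
Qed.

Lemma uniq_wedges : uniq gE.
Proof. exact: map_uniq uniq_gE. Qed.

Lemma in_all_edges e : (e \in all_edges) = (e \in map wpe gE).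
Proof. by rewrite /all_edges finset.inE. Qed.

Lemma edge_of_rel X x y : X \subset all_edges -> edge_rel X x y ->
  exists w, [/\ w \in gE, wpe w \in X, wpe w = [set x; y] &
    (w.1.1 = x /\ w.1.2 = y) \/ (w.1.1 = y /\ w.1.2 = x)].
Proof.
move=> sX; rewrite /edge_rel /= => xy.
have := fintype.subsetP sX _ xy; rewrite in_all_edges => /mapP[w wg E].
by exists w; split; rewrite -?E //; apply: pedge_eq.
Qed.

Lemma activeP lab b :
  reflect (exists p, [/\ p \in ps0, lab p.1 != lab p.2 &
                      lab p.1 = b \/ lab p.2 = b]) (b \in active lab).
Proof.
rewrite inE; apply: (iffP hasP) => [[_ /mapP[p pp ->] /= /andP[ne]]|].
  by move=> /orP[] /eqP ?; exists p; split=> //; [left|right].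
case=> p [pp ne pb]; exists (lab p.1, lab p.2); first exact: map_f.
by rewrite /= ne; case: pb => ->; rewrite eqxx ?orbT.
Qed.

(** Weak duality for one step: a feasible set must leave every active component, and [rate] counts
    the active ends of the edges that do so. *)
Lemma card_active_le lab X : X \subset all_edges -> connects X ps0 ->
  (#|active lab| <= \sum_(w <- gE | wpe w \in X) rate lab w)%N.
Proof.
move=> sX /connectsP cX.
apply: (@leq_trans (\sum_(b in active lab)
    \sum_(w <- gE | wpe w \in X) crosses lab w * touch lab b w)).
  rewrite -sum1_card; apply: leq_sum => b /activeP[p [pp ne pb]].
  have [x [y [xy lx ly]]] : exists x y,
      [/\ edge_rel X x y, lab x == b & ~~ (lab y == b)].
    have cp := cX _ pp; case: pb => <-.
      apply: (connect_exit (P := fun z => lab z == lab p.1) cp) => //.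
      by rewrite eq_sym.
    rewrite edge_connect_sym in cp.
    exact: (connect_exit (P := fun z => lab z == lab p.2) cp).
  have [w [wg wX _ wxy]] := edge_of_rel sX xy.
  rewrite (big_rem w) //= wX.
  apply: leq_trans (leq_addr _ _); rewrite muln_gt0 /crosses /touch.
  case: wxy => -[-> ->]; rewrite (eqP lx).
    by rewrite eqxx add1n andbT lt0b eq_sym.
  by rewrite eqxx addn1 andbT lt0b.
rewrite exchange_big /=; apply: leq_sum => w _.
by rewrite -big_distrr /= /touch big_split /= !sum_eq_mem rateE.
Qed.

(** Keep the side [P z = c] fixed and send the other side to [r]. Both ends of [w] go to [r], and
    any other edge of [X] is fixed or collapses, so a path in [X] becomes one that avoids [w]. *)
Lemma connects_subD1 X w (c : bool) (P : pred V) r :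
  X \subset all_edges -> w \in gE -> wpe w \in X -> P r = c ->
  (forall z, z \in wpe w -> P z = c -> z = r) ->
  (forall w', w' \in gE -> wpe w' \in X -> w' != w -> P w'.1.1 = P w'.1.2) ->
  forall x y, P x = c -> P y = c ->
  connect (edge_rel X) x y -> connect (edge_rel (X :\ wpe w)) x y.
Proof.
move=> sX wg wX Pr rP Pw x y Px Py.
pose f z := if P z == c then z else r.
have fx : f x = x by rewrite /f Px eqxx.
have fy : f y = y by rewrite /f Py eqxx.
move=> cxy; rewrite -fx -fy; apply: connect_hom cxy => {x y Px Py fx fy} x y xy.
have [w' [w'g w'X E wxy]] := edge_of_rel sX xy.
case: (eqVneq w' w) => [w'w|ne].
  have fr z : z \in wpe w -> f z = r.
    by move=> zw; rewrite /f; case: eqP => // /rP; apply.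
  by rewrite !fr // -w'w E !inE eqxx ?orbT.
have Pxy : P x = P y by have := Pw _ w'g w'X ne; case: wxy => -[-> ->].
rewrite /f Pxy; case: ifP => _ //; apply: connect1.
rewrite /edge_rel /= !inE -E w'X andbT.
by apply: contraNneq ne => /wpe_inj ->.
Qed.

(* If an inactive component were left by a single edge of a minimal solution,
   then that edge could be removed: reroute by collapsing the other side to
   the endpoint of the edge. *)
Lemma inactive_touch lab X b w :
  X \subset all_edges -> minimal X -> b \notin active lab ->
  w \in gE -> wpe w \in X -> crosses lab w -> (0 < touch lab b w)%N ->
  exists w', [/\ w' \in gE, wpe w' \in X, crosses lab w', w' != w &
                 (0 < touch lab b w')%N].
Proof.
move=> sX [cX mX] nb wg wX cw tw.
case: (boolP (has (fun w' => [&& wpe w' \in X, crosses lab w', w' != w &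
   (0 < touch lab b w')%N]) gE)) => [/hasP[w' w'g /and4P[]]|/hasPn none].
  by move=> *; exists w'.
case/negP: (mX _ wX); apply/connectsP => p pp.
pose P z := lab z == b.
have Pw w' : w' \in gE -> wpe w' \in X -> w' != w -> P w'.1.1 = P w'.1.2.
  move=> w'g w'X ne; have := none _ w'g; rewrite w'X ne /= /crosses /touch /P.
  by case: eqVneq => [->//|]; rewrite -leqNgt leqn0 addn_eq0 !eqb0 /= =>
     _ /andP[/negbTE-> /negbTE->].
have Pp : P p.1 = P p.2.
  case: (eqVneq (P p.1) (P p.2)) => // ne; case/negP: nb; apply/activeP.
  exists p; split=> //; first by apply: contraNneq ne => E; rewrite /P E.
  move: ne; rewrite /P; case: (eqVneq (lab p.1) b) => [|_]; first by left.
  by case: (eqVneq (lab p.2) b) => //; right.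
have Pcw : P w.1.1 != P w.1.2.
  move: cw tw; rewrite /crosses /touch /P.
  case: (eqVneq (lab w.1.1) b) => [->|]; first by rewrite eq_sym => /negbTE->.
  by case: (eqVneq (lab w.1.2) b).
have cp : connect (edge_rel X) p.1 p.2 by apply: (connectsP _ _ cX).
case: (eqVneq (P p.1) (P w.1.1)) => E.
  apply: (@connects_subD1 X w (P p.1) P w.1.1) => // z.
  rewrite !inE => /orP[/eqP //|/eqP-> E2].
  by rewrite E2 E eqxx in Pcw.
have {}E : P p.1 = P w.1.2 by move: E Pcw; case: (P _); case: (P _); case: (P _).
apply: (@connects_subD1 X w (P p.1) P w.1.2) => // z.
rewrite !inE => /orP[/eqP-> E2|/eqP //].
by rewrite E2 E eqxx in Pcw.
Qed.

(** Acyclicity over the components of [lab], with the edges in the order of their merges: a run of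
    the algorithm satisfies it by construction. *)
Fixpoint indep lab H : bool :=
  if H is w :: H' then crosses lab w && indep (merge_lab lab w) H' else true.

Lemma indep_crosses lab H w : indep lab H -> w \in H -> crosses lab w.
Proof.
elim: H lab => //= v H IH lab /andP[cv iH]; rewrite inE => /predU1P[->//|wH].
have := IH _ iH wH; rewrite /crosses; apply: contra_neq.
by rewrite /merge_lab /= => ->.
Qed.

Lemma merge_lab_finer lab lab2 w :
  (forall x y, lab2 x = lab2 y -> lab x = lab y) ->
  forall x y, merge_lab lab2 w x = merge_lab lab2 w y ->
              merge_lab lab w x = merge_lab lab w y.
Proof.
move=> fin x y; rewrite /merge_lab /relab /=.
have lab2E u v : lab2 u == lab2 v -> lab u == lab v by move=> /eqP/fin->.
case: ifP => [/lab2E-> |_]; case: ifP => [/lab2E-> |_] // /fin E.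
- by rewrite -E; case: ifP.
- by rewrite E; case: ifP => // /eqP.
- by rewrite E.
Qed.

(* An independent set of merges reduces the number of components by its size;
   components that it does not touch survive. *)
Lemma indep_count X (Z : {set V}) lab lab2 H :
  (forall x y, lab2 x = lab2 y -> lab x = lab y) -> indep lab H ->
  Z \subset [set lab2 x | x : V] ->
  (forall w, w \in H -> wpe w \in X -> forall z, z \in Z -> touch lab2 z w = 0%N) ->
  (count (fun w => wpe w \in X) H + #|Z| <= #|[set lab2 x | x : V]|)%N.
Proof.
elim: H lab lab2 => [|w H IH] lab lab2 fin /= => [_ sZ _|/andP[cw iH] sZ nt].
  by rewrite add0n subset_leq_card.
(* An edge outside [X] is merged in [lab] only, so [lab2] stays finer; thus [lab2] records the
   merges due to [X] alone. *)
case: (boolP (wpe w \in X)) => wX; last first.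
  rewrite add0n; apply: IH iH sZ _ => [x y /fin E|w' w'H].
    by rewrite /merge_lab /= E.
  by apply: nt; rewrite inE w'H orbT.
have cw2 : lab2 w.1.1 != lab2 w.1.2 by apply: contraNneq cw => /fin->.
have ntw z : z \in Z -> lab2 w.1.1 <> z /\ lab2 w.1.2 <> z.
  move=> zZ; have := nt w (mem_head _ _) wX z zZ; rewrite /touch.
  by case: eqP => //; case: eqP.
rewrite -addnA add1n.
apply: (@leq_trans (#|[set merge_lab lab2 w x | x : V]|).+1); last first.
  apply: proper_card; apply/fintype.properP; split.
    apply/fintype.subsetP => _ /imsetP[x _ ->]; rewrite /merge_lab /relab /=.
    by case: ifP => _; apply: imset_f.
  exists (lab2 w.1.1); first exact: imset_f.
  apply/imsetP => -[x _]; rewrite /merge_lab /relab /=.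
  by case: ifP => [_ E|/eqP ne E]; [rewrite E eqxx in cw2|case: ne].
rewrite ltnS; apply: (IH _ _ (merge_lab_finer fin) iH).
  apply/fintype.subsetP => z zZ; have /imsetP[x _ zx] := fintype.subsetP sZ _ zZ.
  apply/imsetP; exists x => //; rewrite /merge_lab /relab /= -zx.
  by case: eqP => // E; have [/(_ (esym E))] := ntw _ zZ.
move=> w' w'H w'X z zZ; have := nt w' _ w'X z zZ.
rewrite inE w'H orbT => /(_ isT); rewrite /touch /merge_lab /relab /=.
have [_ n2] := ntw _ zZ; move: n2 => /eqP/negbTE n2.
case: eqP => // n3; case: eqP => // n4 _.
by case: ifP => _; case: ifP => _; rewrite ?n2 //; do ?case: eqP.
Qed.

(* In the forest obtained by contracting the current components, the inactive
   ones have degree 0 or at least 2, so the active ones have average degree at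
   most 2. *)
Lemma rate_le lab X H : X \subset all_edges -> minimal X -> {subset H <= gE} ->
  (forall w, w \in gE -> wpe w \in X -> crosses lab w -> w \in H) ->
  indep lab H ->
  (\sum_(w <- gE | wpe w \in X) rate lab w <= 2 * #|active lab|)%N.
Proof.
move=> sX mX sH XH iH.
pose Xc := [seq w <- gE | (wpe w \in X) && crosses lab w].
have uXc : uniq Xc by rewrite filter_uniq ?uniq_wedges.
pose T b := has (fun w => (0 < touch lab b w)%N) Xc.
pose B := [set lab x | x : V].
pose U := [set b in B | (b \notin active lab) && T b].
pose Z := [set b in B | (b \notin active lab) && ~~ T b].
have cB : (#|B| <= #|active lab| + #|U| + #|Z|)%N.
  rewrite -(cardsID (active lab) B) -addnA leq_add //.
    by rewrite subset_leq_card // finset.subsetIr.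
  rewrite -(cardsID [set b | T b] (B :\: active lab)) leq_add //;
    by rewrite subset_leq_card //; apply/fintype.subsetP => b; rewrite !inE;
       case: (act _ b); case: (T b); rewrite ?andbT ?andbF.
(* Forest bound: [Xc] has no more edges than there are components besides the isolated ones in
   [Z]. *)
have H1 : (size Xc + #|Z| <= #|B|)%N.
  apply: (@leq_trans (count (fun w => wpe w \in X) H + #|Z|)).
    rewrite leq_add2r -size_filter uniq_leq_size // => w.
    by rewrite !mem_filter => /andP[/andP[wX cw] wg]; rewrite wX XH.
  apply: (indep_count (lab := lab)) => //.
  - by apply/fintype.subsetP => b; rewrite inE => /andP[].
  - move=> w wH wX z; rewrite inE => /and3P[zB _ /hasPn nT].
    apply/eqP; rewrite -leqn0 leqNgt; apply: nT.
    by rewrite mem_filter wX (indep_crosses iH wH) sH.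
(* Count of edge ends: the active ones make up [rate], and by [inactive_touch] every component in
   [U] takes at least two of the others. *)
have H2 : (\sum_(w <- Xc) rate lab w + 2 * #|U| <= 2 * size Xc)%N.
  apply: (@leq_trans (\sum_(w <- Xc) (rate lab w + \sum_(b in U) touch lab b w))).
    rewrite [leqRHS]big_split /= leq_add2l exchange_big /= mulnC -sum_nat_const.
    apply: leq_sum => b; rewrite inE => /and3P[_ nb /hasP[w wXc tw]].
    have := wXc; rewrite mem_filter => /andP[/andP[wX cw] wg].
    have [w' [w'g w'X cw' ne tw']] := inactive_touch sX mX nb wg wX cw tw.
    rewrite (bigD1_seq w) //= (big_rem w') /=; last first.
      by rewrite mem_filter w'X cw'.
    by rewrite ne addnA (leq_trans _ (leq_addr _ _)) // (leq_add tw tw').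
  rewrite -sum1_size big_distrr /=; apply: leq_sum => w _.
  rewrite big_split /= !sum_eq_mem rateE muln1.
  have AU x : ((x \in active lab) + (x \in U) <= 1)%N.
    by rewrite /U [x \in [set b in _ | _]]finset.inE; case: (x \in active lab);
      rewrite /= ?andbF // leq_b1.
  apply: leq_trans (leq_add (AU (lab w.1.1)) (AU (lab w.1.2))).
  by rewrite addnACA leq_add2r; case: crosses; rewrite ?mul1n.
have -> : (\sum_(w <- gE | wpe w \in X) rate lab w = \sum_(w <- Xc) rate lab w)%N.
  rewrite /Xc big_filter big_mkcondr /=; apply: eq_bigr => w _.
  by rewrite rateE; case: crosses.
rewrite -(leq_add2r (2 * #|U|)); apply: leq_trans H2 _.
rewrite -mulnDr leq_mul2l /= -(leq_add2r #|Z|).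
exact: leq_trans cB.
Qed.

Lemma merge_lab_eq lab w x y : lab x = lab y -> merge_lab lab w x = merge_lab lab w y.
Proof. by rewrite /merge_lab /= => ->. Qed.

Lemma merge_lab_crosses lab w : ~~ crosses (merge_lab lab w) w.
Proof.
rewrite /crosses negbK /merge_lab /relab /= eqxx.
by case: (eqVneq (lab w.1.2) (lab w.1.1)) => [->|].
Qed.

Lemma count_lt (T : eqType) (a a' : pred T) s x :
  (forall y, a' y -> a y) -> x \in s -> a x -> ~~ a' x ->
  (count a' s < count a s)%N.
Proof.
move=> sub; elim: s => //= y s IH; rewrite inE => /predU1P[<- ax a'x|xs ax a'x].
  by rewrite ax (negbTE a'x) add0n add1n ltnS sub_count.
rewrite -addnS; apply: leq_add (IH xs ax a'x).
by case: (boolP (a' y)) => // /sub ->.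
Qed.

Lemma crosses_rate lab w : (0 < rate lab w)%N -> crosses lab w.
Proof. by rewrite rateE; case: crosses. Qed.

(** Growth cannot get stuck: a path joining the pair in the whole graph leaves the component of
    [p.1], which is active as long as the pair is separated. *)
Lemma separated_exit lab p : p \in ps0 -> lab p.1 != lab p.2 ->
  exists w, [/\ w \in gE, crosses lab w & (0 < rate lab w)%N].
Proof.
move=> pp ne; have ne' : ~~ (lab p.2 == lab p.1) by rewrite eq_sym.
have [x [y [xy lx ly]]] := connect_exit (P := fun z => lab z == lab p.1)
  (connectsP _ _ conn_gE _ pp) (eqxx _) ne'.
have [w [wg _ _ wxy]] := edge_of_rel (subxx _) xy.
have aw : lab x \in active lab.
  by apply/activeP; exists p; split=> //; left; rewrite (eqP lx).
have cw : crosses lab w.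
  by move: ly; rewrite -(eqP lx) /crosses; case: wxy => -[-> ->]; rewrite // eq_sym.
exists w; split=> //; rewrite rateE cw mul1n.
by case: wxy => -[-> ->]; rewrite aw ?addn1.
Qed.

(* [Y] is the total dual grown: it is a lower bound for every feasible set and
   the loads on a minimal solution inside the final forest sum to at most 2Y. *)
Lemma gw_run k lab sl F :
  (forall w, w \in gE -> 0 <= sl w) -> (count (crosses lab) gE <= k)%N ->
  exists lab' sl' F' Y,
    iter k gwstep (rep gE lab sl, (labs lab ps0, F)) =
      (rep gE lab' sl', (labs lab' ps0, F' ++ F)) /\
    [/\ {subset F' <= gE} /\ indep lab (rev F'),
        forall p, p \in ps0 -> lab' p.1 = lab' p.2,
        (forall X, (forall x y, lab x = lab y -> connect (edge_rel X) x y) ->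
           (forall w, w \in F' -> wpe w \in X) ->
           forall x y, lab' x = lab' y -> connect (edge_rel X) x y),
        (forall w, w \in gE -> 0 <= sl' w <= sl w) /\
        (forall w, w \in F' -> sl' w = 0)
      & [/\ 0 <= Y,
         (forall X, X \subset all_edges -> connects X ps0 ->
           Y <= \sum_(w <- gE | wpe w \in X) (sl w - sl' w))
        & (forall X, X \subset all_edges -> minimal X ->
            (forall w, w \in gE -> wpe w \in X -> crosses lab w -> w \in F') ->
            \sum_(w <- gE | wpe w \in X) (sl w - sl' w) <= Y *+ 2)]].
Proof.
have stop lab0 sl0 : (forall w, w \in gE -> 0 <= sl0 w) ->
    (forall p, p \in ps0 -> lab0 p.1 = lab0 p.2) ->
    [/\ {subset [::] <= gE} /\ indep lab0 (rev [::]),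
        forall p, p \in ps0 -> lab0 p.1 = lab0 p.2,
        (forall X, (forall x y, lab0 x = lab0 y -> connect (edge_rel X) x y) ->
           (forall w, w \in [::] -> wpe w \in X) ->
           forall x y, lab0 x = lab0 y -> connect (edge_rel X) x y),
        (forall w, w \in gE -> 0 <= sl0 w <= sl0 w) /\
        (forall w, w \in [::] -> sl0 w = 0)
      & [/\ 0 <= 0 :> R,
         (forall X, X \subset all_edges -> connects X ps0 ->
           0 <= \sum_(w <- gE | wpe w \in X) (sl0 w - sl0 w))
        & (forall X, X \subset all_edges -> minimal X ->
            (forall w, w \in gE -> wpe w \in X -> crosses lab0 w -> w \in [::]) ->
            \sum_(w <- gE | wpe w \in X) (sl0 w - sl0 w) <= 0 *+ 2)]].
  move=> sl00 lp; split=> //; first by split=> // w wg; rewrite lexx sl00.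
  split=> // X _ _; first by rewrite big1 // => w _; rewrite subrr.
  by move=> _; rewrite mul0rn big1 // => w _; rewrite subrr.
elim: k lab sl F => [|k IH] lab sl F sl0 ck.
  exists lab, sl, [::], 0; split=> //; apply: stop => // p pp.
  apply/eqP/negPn/negP => /(separated_exit pp)[w [wg cw _]].
  by move: ck; rewrite leqNgt -has_count => /hasP; case; exists w.
rewrite iterSr; case: (gwstepP gE ps0 lab sl F) => [[none ->]|].
  have lp p : p \in ps0 -> lab p.1 = lab p.2.
    move=> pp; apply/eqP/negPn/negP => /(separated_exit pp)[w [wg cw]].
    by rewrite none.
  have -> : iter k gwstep (rep gE lab sl, (labs lab ps0, F)) =
     (rep gE lab sl, (labs lab ps0, F)).
    elim: k {IH ck} => //= k ->.
    case: (gwstepP gE ps0 lab sl F) => [[_ ->]//|[w [d [wg rw]]]].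
    by rewrite none in rw.
  by exists lab, sl, [::], 0; split=> //; apply: stop.
move=> [w0 [d [w0g rw0 dw0 dle ->]]].
set lab1 := merge_lab lab w0; set sl1 := fun w => _.
have cw0 := crosses_rate rw0.
have d0 : 0 <= d.
  by have := sl0 _ w0g; rewrite -dw0 pmulr_lge0 // ltr0n.
have sl10 w : w \in gE -> 0 <= sl1 w.
  move=> wg; rewrite /sl1; case: (posnP (rate lab w)) => [->|rw].
    by rewrite mulr0 subr0 sl0.
  by rewrite subr_ge0 dle.
have sl1le w : sl1 w <= sl w by rewrite /sl1 lerBlDr lerDl mulr_ge0.
(* The edge [w0] becomes internal and no internal edge crosses again, so one step per edge of the
   graph is enough. *)
have ck1 : (count (crosses lab1) gE <= k)%N.
  rewrite -ltnS; apply: leq_trans ck.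
  apply: (count_lt _ w0g cw0 (merge_lab_crosses _ _)) => w.
  by apply: contra => /eqP /(merge_lab_eq w0) E; apply/eqP.
have [lab' [sl' [F' [Y [-> [[sF' iF'] lp conF [sl'le sl'0] [Y0 Ylb Yub]]]]]]] :=
  IH lab1 sl1 (w0 :: F) sl10 ck1.
exists lab', sl', (rcons F' w0), (Y + d *+ #|active lab|); split.
  by rewrite cat_rcons.
(* The load of [X] grows by [d] times its total rate and the dual by [d] per active component;
   [card_active_le] and [rate_le] compare the two. *)
have sumE X : \sum_(w <- gE | wpe w \in X) (sl w - sl' w) =
    \sum_(w <- gE | wpe w \in X) (sl1 w - sl' w) +
    d * (\sum_(w <- gE | wpe w \in X) rate lab w)%:R.
  rewrite natr_sum big_distrr /= -big_split /=; apply: eq_bigr => w _.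
  by rewrite /sl1; lra.
split.
- split; first by move=> w; rewrite mem_rcons inE => /predU1P[->//|/sF'].
  by rewrite rev_rcons /= cw0.
- exact: lp.
- move=> X labX FX x y; apply: conF => [{}x {}y|w wF]; last first.
    by apply: FX; rewrite mem_rcons inE wF orbT.
  have cw : connect (edge_rel X) w0.1.1 w0.1.2.
    by apply: connect1; apply: FX; rewrite mem_rcons inE eqxx.
  rewrite /lab1 /merge_lab /relab /=; case: eqP => [x1|_]; case: eqP => [y1|_] E.
  + by apply: labX; rewrite x1 y1.
  + by apply: connect_trans (labX _ _ x1) (connect_trans cw (labX _ _ E)).
  + rewrite edge_connect_sym; apply: connect_trans (labX _ _ y1) (connect_trans cw _).
    by apply: labX; rewrite E.
  + exact: labX.
- split=> [w wg|w].
    have /andP[-> /= le] := sl'le _ wg; exact: le_trans le (sl1le w).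
  rewrite mem_rcons inE => /predU1P[->|/sl'0 //].
  have /andP[h1 h2] := sl'le _ w0g; apply/eqP; rewrite eq_le h1 andbT.
  by apply: le_trans h2 _; rewrite /sl1 dw0 subrr.
- split=> [|X sX cX|X sX mX XF].
  + by rewrite addr_ge0 // mulrn_wge0.
  + rewrite sumE lerD ?Ylb // -mulr_natr ler_wpM2l // ler_nat.
    exact: card_active_le.
  + rewrite sumE mulrnDl lerD //.
      apply: Yub => // w wg wX cw.
      have cw' : crosses lab w.
        by apply: contra cw => /eqP /(merge_lab_eq w0) E; apply/eqP.
      have := XF _ wg wX cw'; rewrite mem_rcons inE => /predU1P[Ew|//].
      by move: cw; rewrite Ew (negbTE (merge_lab_crosses _ _)).
    rewrite -mulrnA -[leRHS]mulr_natr ler_wpM2l // ler_nat mulnC.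
    (* [F'] lists the latest edge first, whereas [indep] follows the order of the merges. *)
    apply: (rate_le sX mX (H := rev (rcons F' w0))) => //.
    * by move=> w; rewrite mem_rev mem_rcons inE => /predU1P[->//|/sF'].
    * by move=> w wg wX cw; rewrite mem_rev; apply: XF.
    * by rewrite rev_rcons /= cw0.
Qed.

End GoemansWilliamson.

(** * Pruning and the 2-approximation *)

Section SteinerForest.
Variables (R : realFieldType) (n : nat).
Local Notation V := 'I_n.
Local Notation wedge := (wedge R n).
Implicit Types (ps : seq (V * V)) (gE F K : seq wedge) (X : {set {set V}}).

Definition pstep ps (st : seq wedge * seq wedge) : seq wedge * seq wedge :=
  if st.1 is w :: todo then
    if conn (map fst (catrev todo st.2)) ps then (todo, st.2)
    else (todo, w :: st.2)
  else st.

Definition prune ps F := (foldl (fun st _ => pstep ps st) (F, [::]) F).2.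

Definition gwinit gE : seq (erec R n) := [seq (w, (w.2, w.1)) | w <- gE].

Definition gwrun gE ps : seq wedge :=
  (foldl (fun st _ => gwstep st) (gwinit gE, (ps, [::])) gE).2.2.

Definition sforest gE ps : seq wedge := prune ps (gwrun gE ps).

Lemma foldl_iter (A B : Type) (f : A -> A) (l : seq B) x :
  foldl (fun st _ => f st) x l = iter (size l) f x.
Proof. by elim: l x => //= y l IH x; rewrite IH -iterSr. Qed.

Lemma lset_wpe K : lset (map fst K) = all_edges K.
Proof. by rewrite /lset /all_edges -map_comp. Qed.

(** An edge that was indispensable when examined remains so, because the set around it only shrinks;
    hence a single pass yields a minimal set. *)
Lemma pruneP ps F : uniq F -> connects (all_edges F) ps ->
  let K := prune ps F in
  [/\ {subset K <= F}, uniq K, connects (all_edges K) ps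
    & forall w, w \in K -> ~~ connects (all_edges K :\ wpe w) ps].
Proof.
move=> uF cF; rewrite /prune foldl_iter.
suff Inv k todo kept : size todo = k -> uniq (todo ++ kept) ->
    connects (all_edges (todo ++ kept)) ps ->
    (forall w, w \in kept -> ~~ connects (all_edges (todo ++ kept) :\ wpe w) ps) ->
    let K := (iter k (pstep ps) (todo, kept)).2 in
    [/\ {subset K <= todo ++ kept}, uniq K, connects (all_edges K) ps
      & forall w, w \in K -> ~~ connects (all_edges K :\ wpe w) ps].
  by have := Inv (size F) F [::] erefl; rewrite cats0; apply.
elim: k todo kept => [|k IH] [|v todo] kept //= => [_ uK cK mK|[sz] uK cK mK].
  by split.
have sub w : w \in todo ++ kept -> w \in v :: (todo ++ kept).
  by rewrite inE => ->; rewrite orbT.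
have sE : all_edges (todo ++ kept) \subset all_edges (v :: (todo ++ kept)).
  by apply/fintype.subsetP => e; rewrite !in_all_edges inE => ->; rewrite orbT.
rewrite -/(iter k.+1 _ _) iterSr /pstep /=.
rewrite connE lset_wpe.
have -> : all_edges (catrev todo kept) = all_edges (todo ++ kept).
  apply/finset.setP => e; rewrite !in_all_edges; apply: (perm_mem (perm_map _ _)).
  by rewrite catrevE perm_cat2r perm_rev.
case: ifP => C.
  have [||||h1 h2 h3 h4] := IH todo kept => //.
  - by case/andP: uK.
  - move=> w wk; apply: contra (mK _ wk); apply: connects_sub.
    exact: finset.setSD.
  - by split=> // w /h1/sub.
have pE : perm_eq (todo ++ v :: kept) (v :: (todo ++ kept)).
  by rewrite -cat_rcons -cats1 -catA perm_catCA.
have eE : all_edges (todo ++ v :: kept) = all_edges (v :: (todo ++ kept)).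
  by apply/finset.setP => e; rewrite !in_all_edges; apply: (perm_mem (perm_map _ pE)).
have [||||h1 h2 h3 h4] := IH todo (v :: kept) => //.
- by rewrite (perm_uniq pE).
- by rewrite eE.
- move=> w; rewrite inE eE => /predU1P[->|]; last exact: mK.
  apply: contraFN C; apply: connects_sub; apply/fintype.subsetP => e.
  by rewrite finset.in_setD1 !in_all_edges /= inE => /andP[/negbTE->].
- by split=> // w /h1; rewrite (perm_mem pE).
Qed.

Lemma indep_uniq (lab : V -> V) F : indep lab F -> uniq F.
Proof.
elim: F lab => //= w F IH lab /andP[_ iF]; rewrite (IH _ iF) andbT.
by apply: contraNN (merge_lab_crosses lab w) => /(indep_crosses iF).
Qed.

(** Edges of [K] are tight, so their cost equals their load, which is at most [2Y] by minimality.
    The load of any feasible [X] is at least [Y] and at most its cost. *)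
Theorem sforestP gE ps : (forall w, w \in gE -> 0 <= w.2) ->
  uniq (map (@wpe R n) gE) -> connects (all_edges gE) ps ->
  let K := sforest gE ps in
  [/\ {subset K <= gE}, uniq K, connects (all_edges K) ps
    & forall X, X \subset all_edges gE -> connects X ps ->
      \sum_(w <- K) w.2 <= (\sum_(w <- gE | wpe w \in X) w.2) *+ 2].
Proof.
move=> c0 uE cE; rewrite /sforest /gwrun foldl_iter.
have -> : gwinit gE = rep gE id snd.
  by apply: eq_map => w; rewrite -surjective_pairing.
have Eps : ps = labs id ps.
  by rewrite -[LHS]map_id; apply: eq_map => w; rewrite -surjective_pairing.
rewrite [X in (X, [::])]Eps.
have [lab' [sl' [F [Y [-> [[sF iF] lp conF [sl'le sl'0] [Y0 Ylb Yub]]]]]]] :=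
  gw_run uE cE (sl := snd) (lab := id) [::] c0 (count_size _ _).
rewrite /= cats0.
have uF : uniq F by have := indep_uniq iF; rewrite rev_uniq.
have cF : connects (all_edges F) ps.
  apply/connectsP => p pp; apply: conF (lp _ pp) => [x y ->|w wF]; first exact: connect0.
  by rewrite in_all_edges map_f.
have [sK uK cK mK] := pruneP uF cF; move: (prune ps F) sK uK cK mK => K sK uK cK mK.
have sKE w : w \in K -> w \in gE by move=> /sK/sF.
have wK w : w \in gE -> (wpe w \in all_edges K) = (w \in K).
  move=> wg; rewrite in_all_edges; apply/mapP/idP => [[v vK E]|wK]; last by exists w.
  by rewrite (wpe_inj uE wg (sKE _ vK) E).
split=> // X sX cX.
have sKX : all_edges K \subset all_edges gE.
  apply/fintype.subsetP => e; rewrite !in_all_edges => /mapP[w wK' ->].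
  by rewrite map_f ?sKE.
have mKX : minimal ps (all_edges K).
  by split=> // e; rewrite in_all_edges => /mapP[w wK' ->]; apply: mK.
have pK : perm_eq K [seq w <- gE | wpe w \in all_edges K].
  apply: uniq_perm uK (filter_uniq _ (uniq_wedges uE)) _ => w.
  rewrite mem_filter; case: (boolP (w \in gE)) => wg; first by rewrite wK ?andbT.
  by rewrite andbF; apply: contraNF wg => /sKE.
have -> : \sum_(w <- K) w.2 =
    \sum_(w <- gE | wpe w \in all_edges K) (w.2 - sl' w).
  rewrite -[RHS]big_filter -(perm_big _ pK) /=; apply: eq_big_seq => w wK'.
  by rewrite sl'0 ?subr0 ?sK.
apply: le_trans (Yub _ sKX mKX _) _.
  by move=> w wg; rewrite wK // => /sK.
rewrite lerMn2r /=; apply: le_trans (Ylb _ sX cX) _.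
rewrite !(big_seq_cond (fun w => wpe w \in X)); apply: ler_sum => w /andP[wg _].
by rewrite lerBlDr lerDl; case/andP: (sl'le _ wg).
Qed.

End SteinerForest.

(** * The online algorithm *)

Section Algorithm.
Variables (R : realType) (n : nat).
Local Notation V := 'I_n.
Local Notation wedge := (wedge R n).
Local Notation request := (request R n).
Implicit Types (gE : seq wedge) (G : wgraph R n) (L : R).

Definition wedges G : seq wedge :=
  [seq (p, ecost G (pedge p)) | p : V * V <- enum {: V * V}
    & (p.1 < p.2)%N && (pedge p \in edges G)].

(* [4 m c] for an edge of cost [c], where [m] is the number of edges *)
Definition scaled gE (w : wedge) : R :=
  foldl (fun a _ => a + (w.2 + w.2 + (w.2 + w.2))) 0 gE.

Definition discount gE L : seq wedge :=
  [seq (w.1, if scaled gE w <= L then 0 else w.2) | w <- gE].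

Definition forest gE L (ps : seq (V * V)) : seq wedge :=
  sforest (discount gE L) ps.

Definition wcost (F : seq wedge) : R := foldl (fun a w => a + w.2) 0 F.

(* A pending request together with its level *)
Definition pending : Type := (request * R)%type.

(** The accumulator holds the accepted pairs, their forest, and the requests left over in reverse
    order. The forest is recomputed rather than extended, so that a refusal bounds from below every
    solution for the accepted pairs and the candidate. *)
Definition svcstep gE L (acc : seq (V * V) * (seq wedge * seq pending))
    (p : pending) : seq (V * V) * (seq wedge * seq pending) :=
  if p.2 <= L + L then
    let F := forest gE L (p.1.1 :: acc.1) in
    if wcost F <= L + L then (p.1.1 :: acc.1, (F, acc.2.2))
    else (acc.1, (acc.2.1, (p.1, L + L) :: acc.2.2))
  else (acc.1, (acc.2.1, p :: acc.2.2)).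

Definition service gE L (pend : seq pending) :=
  foldl (svcstep gE L) ([::], ([::], [::])) pend.

Definition insert (p : pending) (s : seq pending) : seq pending :=
  [seq x <- s | deadline x.1 <= deadline p.1] ++
  p :: [seq x <- s | ~~ (deadline x.1 <= deadline p.1)].

(* Pending requests by increasing deadline, requests still to be released, and
   transmissions so far, the latest first *)
Definition astate : Type :=
  (seq pending * (seq request * seq (R * seq (V * V))))%type.

Definition serve_first gE (st : astate) : astate :=
  if st.1 is h :: _ then
    let a := service gE h.2 st.1 in
    (rev a.2.2, (st.2.1, (deadline h.1, map fst a.2.1) :: st.2.2))
  else st.

Definition release_first gE (st : astate) : astate :=
  if st.2.1 is q :: fut then
    (insert (q, wcost (forest gE 0 [:: q.1])) st.1, (fut, st.2.2))
  else st.

(** Releases win ties: a service at time [t] then knows everything released up to [t], and requests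
    still to come are released strictly later. *)
Definition release_next (st : astate) : bool :=
  if st.2.1 is q :: _ then
    if st.1 is h :: _ then release q <= deadline h.1 else true
  else false.

Definition astep gE (st : astate) : astate :=
  if release_next st then release_first gE st else serve_first gE st.

(** Two steps per request suffice: one releases it, and every service disposes of at least one
    request. The fold acts as a counter. *)
Definition run gE (Q : seq request) : astate :=
  foldl (fun st _ => astep gE (astep gE st)) ([::], (Q, [::])) Q.

Definition transmissions G Q : seq (R * seq (V * V)) :=
  rev (run (wedges G) Q).2.2.

Lemma runE gE Q : run gE Q = iter (size Q).*2 (astep gE) ([::], (Q, [::])).
Proof.
rewrite /run (@foldl_iter _ _ (fun st => astep gE (astep gE st))).
by move: (_, _) => st; elim: (size Q) => //= k ->.
Qed.

Lemma wpe_wedges G : uniq (map (@wpe R n) (wedges G)).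
Proof.
rewrite /wedges -map_comp map_inj_in_uniq; first by rewrite filter_uniq ?enum_uniq.
move=> p p'; rewrite !mem_filter => /andP[/andP[lt _] _] /andP[/andP[lt' _] _].
rewrite /wpe /= => /pedge_eq[[h1 h2]|[h1 h2]].
  by case: p p' h1 h2 {lt lt'} => [a b] [a' b'] /= -> ->.
by move: lt; rewrite h1 h2 ltnNge ltnW.
Qed.

Lemma all_edges_wedges G : all_edges (wedges G) = edges G.
Proof.
apply/finset.setP => e; rewrite in_all_edges; apply/mapP/idP => [[w]|eG].
  by case/mapP => p; rewrite mem_filter => /andP[/andP[_ pG] _] -> ->.
have /eqP/cards2P[x [y [nxy E]]] := edges_card2 eG.
wlog lt : x y nxy E / (x < y)%N.
  move=> H; case: (ltngtP x y) => [lt|lt|/val_inj E2]; first exact: (H x y).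
  - by apply: (H y x); rewrite 1?eq_sym // E finset.setUC.
  - by rewrite E2 eqxx in nxy.
exists ((x, y), ecost G e); last by rewrite /wpe /pedge /= E.
apply/mapP; exists (x, y); last by rewrite /pedge /= -E.
by rewrite mem_filter /= lt /pedge /= -E eG mem_enum.
Qed.

Lemma wedges_cost G w : w \in wedges G ->
  [/\ wpe w \in edges G, w.2 = ecost G (wpe w) & 0 < w.2].
Proof.
move=> wG; have := wG; rewrite -all_edges_wedges in_all_edges.
case/mapP: wG => p; rewrite mem_filter => /andP[/andP[_ pG] _] ->.
by move=> H; split=> //=; [apply: map_f|apply: (ecost_gt0 pG)].
Qed.

Lemma size_wedges_le G : (size (wedges G) <= n ^ 2)%N.
Proof.
rewrite size_map size_filter (leq_trans (count_size _ _)) //.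
by rewrite -cardE card_prod card_ord mulnn.
Qed.

Lemma size_wedges G : size (wedges G) = #|edges G|.
Proof.
rewrite -all_edges_wedges /all_edges cardsE -(size_map (@wpe R n)).
by rewrite (card_uniqP (wpe_wedges G)).
Qed.

Lemma sum_wedges G (X : {set {set V}}) (f : {set V} -> R) :
  X \subset edges G ->
  \sum_(w <- wedges G | wpe w \in X) f (wpe w) = \sum_(e in X) f e.
Proof.
move=> sX; rewrite -(big_map (@wpe R n) (mem X) f) -[LHS]big_filter -[RHS]big_filter.
apply: perm_big; apply: uniq_perm; rewrite ?filter_uniq ?wpe_wedges ?index_enum_uniq //.
move=> e; rewrite !mem_filter mem_index_enum -in_all_edges all_edges_wedges /=.
by case: (boolP (e \in X)) => // /(fintype.subsetP sX) ->.
Qed.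

Lemma scaledE gE w : scaled gE w = w.2 *+ (4 * size gE).
Proof.
have E m (x a : R) : foldl (fun a (_ : wedge) => a + x) a m = a + x *+ size m.
  elim: m a => [|y m IH] a /=; first by rewrite addr0.
  by rewrite IH mulrS addrA.
by rewrite /scaled E add0r mulrnA; congr (_ *+ _); rewrite !mulrS mulr0n; lra.
Qed.

Lemma wcostE F : wcost F = \sum_(w <- F) w.2.
Proof.
have E a : foldl (fun a (w : wedge) => a + w.2) a F = a + \sum_(w <- F) w.2.
  elim: F a => [|y m IH] a /=; first by rewrite big_nil addr0.
  by rewrite IH big_cons addrA.
by rewrite /wcost E add0r.
Qed.

Definition dcost G L (e : {set V}) : R :=
  if ecost G e *+ (4 * #|edges G|) <= L then 0 else ecost G e.

Lemma dcost_le G L e : e \in edges G -> 0 <= dcost G L e <= ecost G e.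
Proof.
by move=> /ecost_gt0 c0; rewrite /dcost; case: ifP; rewrite ?lexx (ltW c0).
Qed.

(** Costs are positive, so nothing is free at level 0: [forest gE 0] is the plain approximation that
    defines the initial levels. *)
Lemma dcost0 G e : e \in edges G -> dcost G 0 e = ecost G e.
Proof.
move=> eG; rewrite /dcost lt_geF // pmulrn_lgt0 ?ecost_gt0 // muln_gt0 /=.
by apply/card_gt0P; exists e.
Qed.

Lemma wpe_discount gE L : map (@wpe R n) (discount gE L) = map (@wpe R n) gE.
Proof. by rewrite /discount -map_comp. Qed.

Lemma all_edges_discount gE L : all_edges (discount gE L) = all_edges gE.
Proof. by rewrite /all_edges wpe_discount. Qed.

Lemma discount_cost G L w : w \in discount (wedges G) L ->
  w.2 = dcost G L (wpe w) /\ wpe w \in edges G.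
Proof.
case/mapP => v vG -> /=; have [eG E _] := wedges_cost vG.
by rewrite scaledE size_wedges E.
Qed.

Lemma sum_discount G L (X : {set {set V}}) : X \subset edges G ->
  \sum_(w <- discount (wedges G) L | wpe w \in X) w.2 =
  \sum_(e in X) dcost G L e.
Proof.
move=> sX; rewrite big_map -(sum_wedges _ sX).
rewrite [LHS]big_seq_cond [RHS]big_seq_cond; apply: eq_bigr => w /andP[wG _].
by have [] := discount_cost (map_f (fun w : wedge =>
  (w.1, if scaled (wedges G) w <= L then 0 else w.2)) wG).
Qed.

Lemma forestP G L (ps : seq (V * V)) : connects (edges G) ps ->
  let F := forest (wedges G) L ps in
  [/\ all_edges F \subset edges G, connects (all_edges F) ps,
      wcost F = \sum_(e in all_edges F) dcost G L e
    & forall X : {set {set V}}, X \subset edges G -> connects X ps ->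
        wcost F <= (\sum_(e in X) dcost G L e) *+ 2].
Proof.
move=> cG.
have c0 w : w \in discount (wedges G) L -> 0 <= w.2.
  by case/discount_cost => -> /(dcost_le L)/andP[].
have u : uniq (map (@wpe R n) (discount (wedges G) L)).
  by rewrite wpe_discount wpe_wedges.
have [|sF uF cF ub] := sforestP c0 u (ps := ps).
  by rewrite all_edges_discount all_edges_wedges.
rewrite all_edges_discount all_edges_wedges in ub.
have sFG : all_edges (sforest (discount (wedges G) L) ps) \subset edges G.
  apply/fintype.subsetP => e; rewrite in_all_edges => /mapP[w /sF wF ->].
  by case: (discount_cost wF).
split=> //; last by move=> X sX cX; rewrite wcostE -(sum_discount _ sX) ub.
rewrite wcostE -(sum_discount _ sFG) -[RHS]big_filter; apply: perm_big.
apply: uniq_perm => // [|w]; first by rewrite filter_uniq ?(map_uniq u).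
rewrite mem_filter in_all_edges.
apply/idP/andP => [wF|[/mapP[v vF E] wG]]; first by rewrite map_f ?sF.
by rewrite (wpe_inj u wG (sF _ vF) E).
Qed.

End Algorithm.

(** * Competitiveness *)

Section Witnesses.
Variables (R : realType) (n : nat) (G : wgraph R n).
Local Notation V := 'I_n.
Local Notation wedge := (wedge R n).
Local Notation request := (request R n).
Local Notation pending := (pending R n).
Implicit Types (L l : R) (X : {set {set V}}) (q r : request) (p : pending).
Implicit Types (W : seq request) (pend : seq pending).

Let gE := wedges G.
Let m := #|edges G|.

(* Any solution for the requests in [W] pays [l / 4], where cheap edges do not
   count and the others count at most [l]. *)
Definition witness W l : Prop :=
  forall X, X \subset edges G -> connects X (map fst W) ->
    l / 4 <= \sum_(e in X | l < ecost G e *+ (8 * m)) Num.min (ecost G e) l.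

(** The cap at [l] does no harm: a counted edge of cost at least [l] pays the bound alone, and if
    there is none the cap changes nothing. Discounting at [l / 2] frees exactly the edges of cost at
    most [l / (8m)]. *)
Lemma witness_dcost W l : 0 <= l ->
  (forall X, X \subset edges G -> connects X (map fst W) ->
     l / 4 <= \sum_(e in X) dcost G (l / 2) e) ->
  witness W l.
Proof.
move=> l0 H X sX cX; have XE e : e \in X -> 0 < ecost G e.
  by move=> eX; apply: ecost_gt0; apply: (fintype.subsetP sX).
have cheap e : (l < ecost G e *+ (8 * m)) = ~~ (ecost G e *+ (4 * m) <= l / 2).
  rewrite -ltNge ltr_pdivrMr // mulr_natr -mulrnA.
  by rewrite (mulnAC 4).
case: (boolP [exists e in X, (l < ecost G e *+ (8 * m)) && (l <= ecost G e)]).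
  case/existsP => e /and3P[eX cE le].
  rewrite (bigD1 e) ?eX //= (min_idPr le); apply: (@le_trans _ _ l); first by lra.
  rewrite lerDl; apply: sumr_ge0 => e' /andP[/andP[e'X _] _].
  by rewrite le_min l0 ltW ?XE.
rewrite negb_exists => /forallP none.
apply: le_trans (H _ sX cX) _; rewrite [leRHS]big_mkcondr /=.
apply: ler_sum => e eX; have := none e; rewrite eX /= negb_and -ltNge.
rewrite /dcost -/m cheap; case: ifP => //= _.
by move=> lt; rewrite (min_idPl (ltW lt)).
Qed.

(** At most [m] edges are free, each of cost at most [L / (4m)]. *)
Lemma sum_cost_dcost X L : 0 <= L -> X \subset edges G ->
  \sum_(e in X) ecost G e <= \sum_(e in X) dcost G L e + L / 4.
Proof.
move=> L0 sX; have [m0|m_gt0] := posnP m.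
  have -> : X = finset.set0 by apply/eqP; rewrite -finset.subset0 -(cards0_eq m0).
  by rewrite !big_set0 add0r divr_ge0.
rewrite -lerBlDl -sumrB ler_pdivlMr // -(ler_pM2r (x := m%:R)) ?ltr0n //.
rewrite -mulrA -natrM big_distrl /=.
apply: (@le_trans _ _ (\sum_(e in X) L)).
  apply: ler_sum => e eX; rewrite mulr_natr /dcost -/m; case: ifP => le.
    by rewrite subr0.
  by rewrite subrr mul0rn.
rewrite sumr_const -[leLHS]mulr_natr ler_wpM2l // ler_nat.
exact: subset_leq_card.
Qed.

Definition solo_cost q : R := wcost (forest gE 0 [:: q.1]).

Lemma connects1 X (s : V * V) : connects X [:: s] = connect (edge_rel X) s.1 s.2.
Proof. by rewrite /connects /= andbT. Qed.

Definition connected q := connect (edge_rel (edges G)) q.1.1 q.1.2.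

Lemma solo_costP q : connected q ->
  exists X, [/\ X \subset edges G, connects X [:: q.1] &
                solo_cost q = \sum_(e in X) ecost G e].
Proof.
move=> cq; have cG : connects (edges G) [:: q.1] by rewrite connects1.
have [sX cX E _] := forestP 0 cG.
eexists; split; [exact: sX|exact: cX|rewrite /solo_cost E].
by apply: eq_bigr => e /(fintype.subsetP sX)/dcost0.
Qed.

Lemma solo_cost_ge0 q : connected q -> 0 <= solo_cost q.
Proof.
move=> /solo_costP[X [sX _ ->]]; apply: sumr_ge0 => e eX.
by rewrite ltW // ecost_gt0 // (fintype.subsetP sX).
Qed.

(** If a solution has cost [d] after the discount at [l / 2], its full cost is at most [d + l / 8];
    the approximation gives [l <= 2d + l / 4], that is [d >= 3l / 8]. *)
Lemma witness_solo q : connected q -> witness [:: q] (solo_cost q).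
Proof.
move=> cq; have l0 := solo_cost_ge0 cq.
apply: witness_dcost => // X sX cX.
have cG : connects (edges G) [:: q.1] by rewrite connects1.
have [_ _ _ /(_ _ sX cX)] := forestP 0 cG; rewrite -/gE -/(solo_cost q).
rewrite (eq_bigr (ecost G)) => [|e /(fintype.subsetP sX)/dcost0 //].
have := sum_cost_dcost (divr_ge0 l0 (ler0n _ 2)) sX.
by move: (\sum_(e in X) _) (\sum_(e in X) _) => s d h1 h2; lra.
Qed.

(** The approximation exceeds [2L], so every solution has discounted cost above [L], where
    [(L + L) / 4] is required. *)
Lemma witness_reject W L : 0 <= L -> (forall r, r \in W -> connected r) ->
  L + L < wcost (forest gE L (map fst W)) -> witness W (L + L).
Proof.
move=> L0 cW lt; apply: witness_dcost; first by rewrite addr_ge0.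
move=> X sX cX; have -> : (L + L) / 2 = L by lra.
have cG : connects (edges G) (map fst W).
  by apply/connectsP => _ /mapP[r rW ->]; apply: cW.
have [_ _ _ /(_ _ sX cX)] := forestP L cG; rewrite -/gE => le.
by move: (\sum_(e in X) _) le => s; lra.
Qed.

Definition by_deadline : rel pending :=
  fun x y => deadline x.1 <= deadline y.1.

(* Outcome of a service at level [L]: [W] is served, and those left over at
   level at most [2L] are raised to [2L], with a witness for it. *)
Definition service_spec L pend
    (a : seq (V * V) * (seq wedge * seq pending)) : Prop :=
  exists W : seq pending,
  [/\ {subset W <= pend} /\ a.1 = map (fun x => x.1.1) W,
      (forall x, x \in W -> x.2 <= L + L),
      [/\ all_edges a.2.1 \subset edges G, connects (all_edges a.2.1) a.1
        & \sum_(e in all_edges a.2.1) dcost G L e <= L + L],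
      (forall x, x \in pend -> x \in W \/
         exists2 y, y \in a.2.2 & y.1 = x.1)
    & subseq (map fst (rev a.2.2)) (map fst pend) /\
      (forall y, y \in a.2.2 -> exists2 x, x \in pend & x.1 = y.1 /\
         (y = x /\ L + L < x.2 \/
          [/\ y.2 = L + L, x.2 <= L + L &
           exists W' : seq pending,
             [/\ witness (map fst W') (L + L),
                 (forall z, z \in W' -> z \in pend /\ z.2 <= L + L)
               & (forall z, z \in W' -> deadline z.1 <= deadline x.1)]]))].

Lemma serviceP L pend : 0 <= L -> (forall x, x \in pend -> connected x.1) ->
  pairwise by_deadline pend -> service_spec L pend (service gE L pend).
Proof.
move=> L0; rewrite /service; elim/last_ind: pend => [|pend p IH] cP srt.
  exists [::]; split=> //=; split=> //.
  - by rewrite /all_edges /=; apply/fintype.subsetP => e; rewrite finset.inE.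
  - by rewrite big1 ?addr_ge0 // => e; rewrite finset.inE.
move: srt; rewrite pairwise_rcons => /andP[/allP lep srt].
have cP' x : x \in pend -> connected x.1.
  by move=> xp; apply: cP; rewrite mem_rcons inE xp orbT.
have cp : connected p.1 by apply: cP; rewrite mem_rcons inE eqxx.
have inr x : x \in pend -> x \in rcons pend p.
  by move=> xp; rewrite mem_rcons inE xp orbT.
have inp : p \in rcons pend p by rewrite mem_rcons inE eqxx.
rewrite foldl_rcons; case: (foldl _ _ _) (IH cP' srt) => Qs [F rem].
case=> W [/= [sW ->] lW [sF cF dF] dis [sub rm]].
have keep (y : pending) : y.1 = p.1 ->
    subseq (map fst (rev (y :: rem))) (map fst (rcons pend p)).
  by move=> E; rewrite rev_cons !map_rcons E -!cats1 cat_subseq.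
have keep0 : subseq (map fst (rev rem)) (map fst (rcons pend p)).
  by rewrite map_rcons -cats1 (subseq_trans sub) // prefix_subseq.
have old y : y \in rem -> exists2 x, x \in rcons pend p & x.1 = y.1 /\
         (y = x /\ L + L < x.2 \/
          [/\ y.2 = L + L, x.2 <= L + L &
           exists W' : seq pending,
             [/\ witness (map fst W') (L + L),
                 (forall z, z \in W' -> z \in rcons pend p /\ z.2 <= L + L)
               & (forall z, z \in W' -> deadline z.1 <= deadline x.1)]]).
  case/rm => x xp [E H]; exists x; first exact: inr.
  split=> //; case: H => H; [by left|right].
  case: H => h1 h2 [W' [w1 w2 w3]]; split=> //; exists W'; split=> // z /w2[zp ?].
  by split=> //; apply: inr.
rewrite /svcstep /=; case: ifP => lp; last first.
  exists W; split=> //=.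
  - by split=> // x /sW/inr.
  - move=> x; rewrite mem_rcons inE => /predU1P[->|/dis[|[y yr E]]].
    + by right; exists p; rewrite // inE eqxx.
    + by left.
    + by right; exists y; rewrite // inE yr orbT.
  - split; first exact: keep.
    move=> y; rewrite inE => /predU1P[->|]; last exact: old.
    by exists p => //; split=> //; left; rewrite ltNge lp.
have cG : connects (edges G) (map fst (map fst (p :: W))).
  apply/connectsP => _ /mapP[_ /mapP[x xW ->] ->].
  by move: xW; rewrite inE => /predU1P[->//|/sW/cP'].
have Emap : p.1.1 :: map (fun x => x.1.1) W = map fst (map fst (p :: W)).
  by rewrite -map_comp.
rewrite Emap; have [sF' cF' costF' _] := forestP L cG.
case: ifP => le.
  exists (p :: W); split=> //=.
  - split; first by move=> x; rewrite inE => /predU1P[->//|/sW/inr].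
    by rewrite -map_comp.
  - by move=> x; rewrite inE => /predU1P[->|/lW].
  - by split=> //; rewrite -costF'.
  - move=> x; rewrite mem_rcons inE => /predU1P[->|/dis[xW|]].
    + by left; rewrite inE eqxx.
    + by left; rewrite inE xW orbT.
    + by right.
exists W; split=> //=.
- by split=> // x /sW/inr.
- move=> x; rewrite mem_rcons inE => /predU1P[->|/dis[|[y yr E]]].
  + by right; exists (p.1, L + L); rewrite // inE eqxx.
  + by left.
  + by right; exists y; rewrite // inE yr orbT.
- split; first exact: keep.
  (* The witness for the raise of [p] is [p] with everything accepted so far; by [lep] none of these
     has a later deadline. *)
  move=> y; rewrite inE => /predU1P[->|]; last exact: old.
  exists p => //; split=> //; right; split=> //; exists (p :: W); split.
  + apply: witness_reject => // [r /mapP[x]|]; last by rewrite ltNge le.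
    by rewrite inE => /predU1P[->->//|/sW/cP' ? ->].
  + by move=> z; rewrite inE => /predU1P[->//|zW]; rewrite inr ?sW ?lW.
  + by move=> z; rewrite inE => /predU1P[->//|/sW/lep].
Qed.

Lemma size_service_le L acc pend :
  (size (foldl (svcstep gE L) acc pend).2.2 <= size acc.2.2 + size pend)%N.
Proof.
elim: pend acc => [|p pend IH] acc /=; first by rewrite addn0.
apply: leq_trans (IH _) _; rewrite addnS -addSn leq_add2r /svcstep.
by case: ifP => _; first case: ifP => _ /=.
Qed.

(* The request with the earliest deadline is always served, since its level
   bounds its own connection cost. *)
Lemma size_service L h pend : h.2 = L -> connected h.1 -> solo_cost h.1 <= L ->
  (size (service gE L (h :: pend)).2.2 <= size pend)%N.
Proof.
move=> hL ch le; have L0 : 0 <= L := le_trans (solo_cost_ge0 ch) le.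
rewrite /service /= {2}/svcstep hL lerDl L0 /=.
have [X [sX cX E]] := solo_costP ch.
have cG : connects (edges G) [:: h.1.1] by rewrite connects1.
have [_ _ _ /(_ _ sX cX) ub] := forestP L cG.
rewrite ifT; first by apply: leq_trans (size_service_le _ _ _) _.
(* The set [X] of cost [solo_cost h.1 <= L] competes in the discounted problem, so the new forest
   costs at most [2L], the budget. *)
apply: le_trans ub _; rewrite mulr2n; apply: lerD; apply: le_trans le; rewrite E;
  by apply: ler_sum => e /(fintype.subsetP sX)/(dcost_le L)/andP[].
Qed.

End Witnesses.

(** * Sums over doubling levels *)

Section Doubling.
Variable R : realFieldType.
Implicit Types (c : R) (l : seq R).

Lemma sum_doubling_head a l : all (fun x => 0 <= x) (a :: l) ->
  pairwise (fun x y => y + y <= x) (a :: l) -> \sum_(x <- a :: l) x <= a + a.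
Proof.
elim: l a => [|b l IH] a; first by rewrite /= andbT big_seq1 lerDl => ->.
move=> /andP[a0 pl] /andP[/andP[ba _] dl]; rewrite big_cons lerD2l.
exact: le_trans (IH _ pl dl) ba.
Qed.

(** Removing the largest term costs at most [c] and halves the bound on the rest. After [K] removals
    the largest term is at most [c], and the geometric series that remains sums to at most [2c]. *)
Lemma sum_min_doubling c K l : 0 <= c -> all (fun x => 0 <= x) l ->
  pairwise (fun x y => y + y <= x) l -> all (fun x => x <= c *+ 2 ^ K) l ->
  \sum_(x <- l) Num.min c x <= c *+ (K + 2).
Proof.
move=> c0; elim: K l => [|K IH] [|a l] pl dl bl;
  try by rewrite big_nil mulrn_wge0.
  apply: (@le_trans _ _ (\sum_(x <- a :: l) x)).
    by apply: ler_sum => x _; rewrite ge_min lexx orbT.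
  apply: le_trans (sum_doubling_head pl dl) _.
  by move: bl => /andP[+ _]; rewrite add0n mulr2n mulr1n => ac; apply: lerD.
rewrite big_cons addSn mulrS lerD ?ge_min ?lexx //.
move: pl dl bl => /andP[_ pl] /andP[/allP da dl] /andP[ba _].
apply: IH => //; apply/allP => x xl; rewrite -(ler_pMn2r (ltn0Sn 1)) -mulrnA -expnSr.
by rewrite mulr2n (le_trans (da _ xl)).
Qed.

End Doubling.

(** * Invariant of the run and charging argument *)

Section Competitive.
Variables (R : realType) (n : nat) (G : wgraph R n).
Local Notation V := 'I_n.
Local Notation request := (request R n).
Local Notation pending := (pending R n).
Local Notation astate := (astate R n).
Variable Q : seq request.
Hypothesis validQ : valid_input G Q.

Let gE := wedges G.

(* Time, level and witness of a past service *)
Definition srec : Type := (R * (R * seq request))%type.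

Definition sched (out : seq (R * seq (V * V))) : schedule R n :=
  output_schedule out.

(* The witness of a service [s] comes after an earlier service [s'] unless the
   level has doubled in between. *)
Definition fresh_after (s s' : srec) : bool :=
  (s.2.1 < s'.2.1 + s'.2.1) ==> all (fun r => s'.1 < release r) s.2.2.

(** The bound by all pending deadlines places every release before the next service. The fourth
    clause makes the witness of a later raise fresh; the fifth gives the witness that the request
    hands over to [H] when it triggers a service. *)
Definition pend_inv (fut : seq request) (pend : seq pending) (H : seq srec)
    (x : pending) : Prop :=
  [/\ x.1 \in Q /\ solo_cost G x.1 <= x.2,
      (forall y, y \in pend -> release x.1 <= deadline y.1),
      (forall q, q \in fut -> release x.1 <= release q),
      (forall s, s \in H -> release x.1 <= s.1 -> s.2.1 + s.2.1 <= x.2)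
    & exists W, [/\ witness G W x.2,
        (forall r, r \in W -> r \in Q /\ deadline r <= deadline x.1)
      & (forall s, s \in H -> x.2 < s.2.1 + s.2.1 ->
           forall r, r \in W -> s.1 < release r)]].

(** [H] is ghost data, latest service first, recording witnesses that the algorithm does not
    compute. The constant [9 / 4] is the budget 2 plus [1 / 4] for the free edges. *)
Definition inv (st : astate) (H : seq srec) : Prop :=
  let: (pend, (fut, out)) := st in
  [/\ exists2 dn, Q = dn ++ fut & forall q, q \in dn ->
        q \in map fst pend \/ has (fun y => serves y q) (sched out),
      pairwise (@by_deadline R n) pend,
      all (fun x : R * {set {set V}} => x.2 \subset edges G) (sched out) /\
        cost G (sched out) <= 9 / 4 * \sum_(s <- H) s.2.1,
      (forall s, s \in H ->
         [/\ 0 <= s.2.1, witness G s.2.2 s.2.1,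
             (forall r, r \in s.2.2 -> r \in Q /\ deadline r <= s.1)
           & (forall q, q \in fut -> s.1 < release q)]) /\
        pairwise fresh_after H
    & (forall x, x \in pend -> pend_inv fut pend H x)].

Lemma validP q : q \in Q -> release q <= deadline q /\ connected G q.
Proof. by case/andP: validQ => _ /allP H /H /andP[]. Qed.

Lemma sorted_release q fut q' dn :
  Q = dn ++ q :: fut -> q' \in fut -> release q <= release q'.
Proof.
move=> E q'f; have /andP[+ _] := validQ; rewrite E.
rewrite sorted_pairwise => [|x y z]; last exact: le_trans.
by rewrite pairwise_cat /= => /and3P[_ _ /andP[/allP H _]]; apply: H.
Qed.

Lemma perm_insert (p : pending) s : perm_eq (insert p s) (p :: s).
Proof.
rewrite /insert -cat1s perm_catCA cat1s perm_cons.
by rewrite perm_filterC.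
Qed.

Lemma mem_insert (p : pending) s x : (x \in insert p s) = (x \in p :: s).
Proof. exact: perm_mem (perm_insert p s) x. Qed.

Lemma insert_sorted (p : pending) s : pairwise (@by_deadline R n) s ->
  pairwise (@by_deadline R n) (insert p s).
Proof.
move=> srt; rewrite /insert pairwise_cat /= !pairwise_filter //= allrel_consr.
have H1 : all (fun x => by_deadline x p)
    [seq x <- s | deadline x.1 <= deadline p.1].
  by apply/allP => x; rewrite mem_filter => /andP[].
have H2 : all (by_deadline p) [seq x <- s | ~~ (deadline x.1 <= deadline p.1)].
  apply/allP => x; rewrite mem_filter -ltNge => /andP[lt _]; exact: ltW.
rewrite H1 H2 /= andbT; apply/allrelP => x y xs ys.
by apply: (@le_trans _ _ (deadline p.1)); [exact: (allP H1)|exact: (allP H2)].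
Qed.

Lemma inv0 : inv ([::], (Q, [::])) [::].
Proof.
split=> //; first by exists [::].
by split=> //; rewrite /cost !big_nil mulr0.
Qed.

(** The new request is released after every past service, so its clauses about [H] are immediate
    with the request itself as witness. *)
Lemma inv_release pend q fut out H :
  release_next (pend, (q :: fut, out)) -> inv (pend, (q :: fut, out)) H ->
  inv (release_first gE (pend, (q :: fut, out))) H.
Proof.
move=> rn [[dn EQ served] srt costH [HH pH] pI].
have qQ : q \in Q by rewrite EQ mem_cat inE eqxx orbT.
have [rdq cq] := validP qQ.
have qpend y : y \in pend -> release q <= deadline y.1.
  case: pend rn srt {served pI} => //= h pend rn /andP[/allP lh _].
  by rewrite inE => /predU1P[->//|/lh]; apply: le_trans.
rewrite /release_first /=; set x0 := (q, _); split.
- exists (rcons dn q); first by rewrite cat_rcons.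
  move=> q'; rewrite mem_rcons inE => /predU1P[->|/served[/mapP[x xp ->]|]].
  + by left; apply/mapP; exists x0; rewrite // mem_insert inE eqxx.
  + by left; apply/mapP; exists x; rewrite // mem_insert inE xp orbT.
  + by right.
- exact: insert_sorted.
- exact: costH.
- split=> // s sH; have [h1 h2 h3 h4] := HH _ sH; split=> // q' q'f.
  by apply: h4; rewrite inE q'f orbT.
move=> x; rewrite mem_insert inE => /predU1P[->|xp].
  split.
  - by rewrite qQ /= lexx.
  - by move=> y; rewrite mem_insert inE => /predU1P[->//|/qpend].
  - by move=> q' q'f; apply: sorted_release EQ q'f.
  - move=> s sH le; have [_ _ _ /(_ q)] := HH _ sH; rewrite inE eqxx.
    by move=> /(_ isT); rewrite ltNge le.
  - exists [:: q]; split; first exact: witness_solo.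
    + by move=> r; rewrite inE => /eqP->.
    + move=> s sH _ r; rewrite inE => /eqP->; have [_ _ _] := HH _ sH.
      by apply; rewrite inE eqxx.
have [h1 h2 h3 h4 h5] := pI _ xp; split=> //.
- move=> y; rewrite mem_insert inE => /predU1P[->/=|/h2 //].
  by apply: le_trans rdq; apply: h3; rewrite inE eqxx.
- by move=> q' q'f; apply: h3; rewrite inE q'f orbT.
Qed.

Lemma cost_cons x S : cost G (x :: S) = \sum_(e in x.2) ecost G e + cost G S.
Proof. by rewrite /cost big_cons. Qed.

Lemma inv_serve h pend fut out H :
  ~~ release_next (h :: pend, (fut, out)) -> inv (h :: pend, (fut, out)) H ->
  exists H', inv (serve_first gE (h :: pend, (fut, out))) H'.
Proof.
move=> rn [[dn EQ served] srt [edgeH costH] [HH pH] pI].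
have [[hQ soloh] h2 h3 h4 [Wh [wh Whd Whr]]] := pI _ (mem_head _ _).
set L := h.2 in soloh wh Whr h4; set t := deadline h.1 in h2 Whd.
have L0 : 0 <= L by apply: le_trans soloh; apply/solo_cost_ge0/(validP hQ).2.
have pc x : x \in h :: pend -> connected G x.1.
  by move=> /pI[[xQ _] _ _ _ _]; have [] := validP xQ.
have tmin x : x \in h :: pend -> t <= deadline x.1.
  move: srt => /= /andP[/allP lh _]; rewrite inE => /predU1P[->//|]; exact: lh.
have tfut q : q \in fut -> t < release q.
  case: fut {h3} rn EQ pI {served} HH => //= q0 fut; rewrite -ltNge => lt EQ _ _.
  rewrite inE => /predU1P[->//|q'f]; apply: lt_le_trans lt _.
  exact: sorted_release EQ q'f.
rewrite /serve_first /=; have := serviceP L0 pc srt.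
case: (service _ _ _) => Qs [F rem].
move=> [W [[sW EQs] lW [sF cF dF] dis [sub rm]]].
move: EQs sF cF dF dis rm => /= EQs sF cF dF dis rm.
exists ((t, (L, Wh)) :: H).
have EF : [set:: [seq [set p.1; p.2] | p <- map fst F]] = all_edges F.
  by rewrite /all_edges -map_comp.
split.
- exists dn => // q /served[/mapP[x xp ->]|]; last first.
    by move=> Hs; right; rewrite /sched /= Hs orbT.
  case: (dis _ xp) => [xW|[y yr E]]; last first.
    by left; rewrite map_rev mem_rev -E map_f.
  right; rewrite /sched /= {1}/serves /= EF.
  have [_ xr _ _ _] := pI _ xp.
  rewrite -/t (xr h) ?inE ?eqxx // tmin //=.
  by move/allP: cF => /(_ x.1.1) ->; rewrite // EQs; apply: (map_f (fun x : pending => x.1.1)).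
- move: srt; rewrite -(pairwise_map fst (fun q q' => deadline q <= deadline q')).
  by rewrite -(pairwise_map fst (fun q q' => deadline q <= deadline q')); apply: subseq_pairwise.
- rewrite /sched /= EF sF edgeH; split=> //.
  rewrite cost_cons /= big_cons mulrDr lerD //.
  apply: le_trans (sum_cost_dcost L0 sF) _.
  by move: (\sum_(e in _) _) dF => d; rewrite /L /= => ?; lra.
- split; last first.
    rewrite /= pH andbT; apply/allP => s sH; apply/implyP => /= lt.
    by apply/allP => r rW; apply: Whr lt r rW.
  move=> s; rewrite inE => /predU1P[->|/HH //]; split=> //.
move=> y; rewrite mem_rev => /rm[x xp [E H1]].
have [[xQ xs] xd xf xH xW] := pI _ xp.
have xy : x.2 <= y.2 by case: H1 => [[-> _]//|[-> ? _]].
split.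
- by rewrite -E xQ (le_trans xs).
- move=> z; rewrite mem_rev => /rm[z' z'p [Ez _]].
  by rewrite -E -Ez; apply: xd.
- by rewrite -E.
- move=> s; rewrite inE => /predU1P[->/= _|sH]; last first.
    by rewrite -E => rs; apply: le_trans xy; apply: xH.
  by case: H1 => [[-> /ltW]//|[-> _ _]].
(* A request that was not raised keeps its witness: its level exceeds [2L], so the new service
   demands no freshness. *)
case: H1 => [[-> lx]|[Ey lx [W' [w1 w2 w3]]]].
  case: xW => Wx [v1 v2 v3]; exists Wx; split=> // s.
  rewrite inE => /predU1P[->/=|]; last exact: v3.
  by rewrite ltNge (ltW lx).
exists (map fst W'); rewrite Ey; split=> //.
- move=> _ /mapP[z zW ->]; have [zp _] := w2 _ zW; split; last by rewrite -E w3.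
  by have [[]] := pI _ zp.
- move=> s; rewrite inE => /predU1P[->/=|sH lt]; first by rewrite ltxx.
  move=> _ /mapP[z zW ->]; have [zp zl] := w2 _ zW.
  (* If [z] were released by the time of [s], its level would be at least twice that of [s]; but the
     members of [W'] have level at most [2L]. *)
  have [_ _ _ zH _] := pI _ zp; rewrite ltNge; apply/negP => /(zH _ sH) le.
  by move: (le_trans le zl); rewrite leNgt lt.
Qed.

Lemma inv_step st H : inv st H -> exists H', inv (astep gE st) H'.
Proof.
case: st => pend [fut out]; rewrite /astep; case: ifP => rn i.
  by case: fut rn i => // q fut rn i; exists H; apply: inv_release.
case: pend rn i => [|h pend] /negbT rn i; first by exists H.
exact: inv_serve i.
Qed.

Lemma inv_iter k : exists H, inv (iter k (astep gE) ([::], (Q, [::]))) H.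
Proof.
elim: k => [|k [H i]]; first by exists [::]; apply: inv0.
by rewrite iterS; apply: inv_step i.
Qed.

(** A potential: a release trades 2 for 1, and a service removes at least one pending request. *)
Definition remaining (st : astate) : nat := (size st.2.1).*2 + size st.1.

Lemma remaining_step st H : inv st H ->
  (remaining (astep gE st) <= (remaining st).-1)%N.
Proof.
case: st => pend [fut out]; rewrite /astep; case: ifP => rn i.
  case: fut rn i => // q fut rn i; rewrite /release_first /remaining /=.
  by rewrite (perm_size (perm_insert _ _)) /= !addnS.
case: pend rn i => [|h pend] rn i.
  rewrite /serve_first /remaining /=; case: fut rn {i} => //=.
have [_ _ _ _ /(_ h (mem_head _ _))[[hQ soloh] _ _ _ _]] := i.
rewrite /serve_first /remaining /= size_rev addnS /= leq_add2l.
by apply: (size_service (G := G)) => //; case: (validP hQ).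
Qed.

Lemma remaining_iter k :
  (remaining (iter k (astep gE) ([::], (Q, [::]))) <= (size Q).*2 - k)%N.
Proof.
elim: k => [|k IH]; first by rewrite /remaining /= addn0 subn0.
have [H i] := inv_iter k; rewrite iterS (leq_trans (remaining_step i)) //.
by rewrite subnS; case: (remaining _) IH => [|r] //=; case: (_ - _)%N.
Qed.

Lemma run_done : exists out, run gE Q = ([::], ([::], out)).
Proof.
have := remaining_iter (size Q).*2; rewrite -runE subnn leqn0.
rewrite /remaining; case: (run gE Q) => pend [fut out] /=.
rewrite addn_eq0 double_eq0 !size_eq0 => /andP[/eqP-> /eqP->].
by exists out.
Qed.

Lemma feasible_mem (S S' : schedule R n) :
  S =i S' -> feasible G Q S = feasible G Q S'.
Proof.
move=> E; rewrite /feasible (eq_all_r E); congr (_ && _).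
by apply: eq_all => q; apply: eq_has_r.
Qed.

Lemma transmissions_inv : exists H,
  [/\ feasible G Q (output_schedule (transmissions G Q)),
      cost G (output_schedule (transmissions G Q)) <=
        9 / 4 * \sum_(s <- H) s.2.1,
      (forall s, s \in H ->
         [/\ 0 <= s.2.1, witness G s.2.2 s.2.1
           & forall r, r \in s.2.2 -> r \in Q /\ deadline r <= s.1])
    & pairwise fresh_after H].
Proof.
have [out Eout] := run_done; have [H] := inv_iter (size Q).*2.
rewrite -runE Eout => -[[dn EQ served] _ [edgeH costH] [HH pH] _].
have EQ' : Q = dn by rewrite EQ cats0.
exists H; split=> //.
- have -> : feasible G Q (output_schedule (transmissions G Q)) =
            feasible G Q (sched out).
    apply: feasible_mem => x; rewrite /transmissions -/gE Eout /output_schedule.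
    by rewrite map_rev mem_rev.
  rewrite /feasible edgeH; apply/allP => q; rewrite {1}EQ' => qdn.
  by case: (served _ qdn).
- rewrite /transmissions -/gE Eout /output_schedule map_rev /cost.
  by rewrite (perm_big (sched out)) // perm_rev.
- by move=> s /HH[h1 h2 h3 _]; split.
Qed.

Lemma sum_bigcup (T : finType) (I : Type) (s : seq I) (P : pred I)
    (F : I -> {set T}) (C : pred T) (f : T -> R) :
  (forall i e, P i -> e \in F i -> 0 <= f e) ->
  \sum_(e in \bigcup_(i <- s | P i) F i | C e) f e <=
  \sum_(i <- s | P i) \sum_(e in F i | C e) f e.
Proof.
move=> f0; suff [] : \sum_(e in \bigcup_(i <- s | P i) F i | C e) f e <=
    \sum_(i <- s | P i) \sum_(e in F i | C e) f e /\
    (forall e, e \in \bigcup_(i <- s | P i) F i -> 0 <= f e) by [].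
elim: s => [|i s [IH IH0]].
  rewrite !big_nil; split; last by move=> e; rewrite finset.inE.
  by rewrite big_pred0 // => e; rewrite finset.inE.
rewrite !big_cons; case: ifP => // Pi; split; last first.
  by move=> e; rewrite finset.in_setU => /orP[/(f0 _ _ Pi)|/IH0].
apply: le_trans (lerD (lexx _) IH).
rewrite [leLHS]big_mkcond [X in _ <= X + _]big_mkcond [X in _ <= _ + X]big_mkcond.
rewrite -big_split /=; apply: ler_sum => e _; rewrite finset.in_setU.
have := f0 _ e Pi; have := IH0 e.
case: (C e); rewrite ?andbF ?andbT ?addr0 //.
case: (e \in F i); case: (e \in \bigcup_(_ <- _ | _) _) => //= h1 h2;
  by rewrite ?addr0 ?add0r // lerDl; apply: h1.
Qed.

(* A transmission of [S] matters for the services whose witness it serves; the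
   levels of these services at least double from one to the next, so that an
   edge is charged fully by a logarithmic number of them only. *)
Lemma sum_levels_le (H : seq srec) (S : schedule R n) (K : nat) :
  (forall s, s \in H ->
     [/\ 0 <= s.2.1, witness G s.2.2 s.2.1
       & forall r, r \in s.2.2 -> r \in Q /\ deadline r <= s.1]) ->
  pairwise fresh_after H -> (8 * #|edges G| <= 2 ^ K)%N -> feasible G Q S ->
  \sum_(s <- H) s.2.1 <= 4 * (cost G S *+ (K + 2)).
Proof.
move=> HH pH leK /andP[/allP Sedge /allP Sserve].
pose hit (s : srec) x := has (serves x) s.2.2.
pose rel_edge (s : srec) e := s.2.1 < ecost G e *+ (8 * #|edges G|).
pose f (s : srec) e := Num.min (ecost G e) s.2.1.
have ce x e : x \in S -> e \in x.2 -> 0 < ecost G e.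
  by move=> /Sedge sx ex; apply: ecost_gt0; apply: (fintype.subsetP sx).
have charge s : s \in H -> s.2.1 / 4 <=
    \sum_(x <- S | hit s x) \sum_(e in x.2 | rel_edge s e) f s e.
  move=> sH; have [l0 wit WQ] := HH _ sH.
  (* The transmissions of [S] that serve part of the witness connect all of it when taken together,
     so they pay its lower bound. *)
  pose X : {set {set V}} := \bigcup_(x <- S | (x \in S) && hit s x) x.2.
  have inX x : x \in S -> hit s x -> x.2 \subset X.
    by move=> xS hx; rewrite /X (big_rem x) //= xS hx finset.subsetUl.
  have sX : X \subset edges G.
    rewrite /X; elim/big_rec: _ => [|x Y /andP[xS _] sY]; first exact: finset.sub0set.
    by rewrite finset.subUset sY Sedge.
  apply: le_trans (wit X sX _) _.
    apply/connectsP => _ /mapP[r rW ->]; have [rQ _] := WQ _ rW.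
    have /hasP[x xS xr] := Sserve _ rQ; have /andP[_] := xr.
    by apply: edge_connect_sub; apply: inX => //; apply/hasP; exists r.
  rewrite [leRHS]big_seq_cond; apply: sum_bigcup => x e /andP[xS _] ex.
  by rewrite /f le_min l0 ltW // (ce x).
have charged x e : x \in S -> e \in x.2 ->
    \sum_(s <- H | hit s x && rel_edge s e) f s e <= ecost G e *+ (K + 2).
  move=> xS ex; have c0 := ltW (ce _ _ xS ex).
  rewrite -big_filter -(big_map (fun s : srec => s.2.1) xpredT (fun l => Num.min (ecost G e) l)).
  apply: sum_min_doubling => //; rewrite ?all_map.
  - by apply/allP => s; rewrite mem_filter => /andP[_ /HH[]].
  - rewrite pairwise_map.
    apply: (@sub_in_pairwise _ [pred s | (s \in H) && hit s x] fresh_after).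
    (* Here [s] is the later service. As [x] serves both [r] and [r'], [r] is released by the time
       of [x], hence by the deadline of [r'], hence by the time of [s']. So the witness of [s] is
       not fresh and the level has doubled. *)
    + move=> s s' /andP[/HH[_ _ sW] /hasP[r rW /andP[/andP[rx _] _]]].
      move=> /andP[/HH[_ _ sW'] /hasP[r' rW' /andP[/andP[_ xr'] _]]] /implyP fresh /=.
      rewrite leNgt; apply/negP => /fresh/allP/(_ _ rW); rewrite ltNge => /negP; apply.
      by apply: le_trans rx (le_trans xr' _); case: (sW' _ rW').
    + by apply/allP => s; rewrite mem_filter /= => /andP[/andP[-> _] ->].
    + exact: subseq_pairwise (filter_subseq _ H) pH.
  - apply/allP => s; rewrite mem_filter => /andP[/andP[_ lt] _] /=.
    by rewrite (le_trans (ltW lt)) // ler_wpMn2l.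
have le4 : \sum_(s <- H) s.2.1 / 4 <= cost G S *+ (K + 2).
  apply: (@le_trans _ _ (\sum_(s <- H) \sum_(x <- S) \sum_(e in x.2)
      (if hit s x && rel_edge s e then f s e else 0))).
    rewrite big_seq [leRHS]big_seq; apply: ler_sum => s sH.
    apply: le_trans (charge _ sH) _; rewrite big_mkcond /=.
    apply: ler_sum => x _; case: (hit s x) => /=; last by rewrite big1.
    by rewrite big_mkcondr.
  rewrite exchange_big /= /cost -sumrMnl big_seq [leRHS]big_seq.
  apply: ler_sum => x xS; rewrite exchange_big /= -sumrMnl; apply: ler_sum => e ex.
  by rewrite -big_mkcond; apply: charged.
move: le4; rewrite -mulr_suml; move: (\sum_(s <- H) _) (cost G S *+ _) => a b; lra.
Qed.

(** The product of [9 / 4], the factor 4 of the witness bound, and [K + 2], where [K] is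
    [(up_log 2 k).*2 + 3]. *)
Definition ratio (k : nat) : R := (9 * (up_log 2 k).*2 + 45)%:R.

Lemma card_edges_le : (8 * #|edges G| <= 2 ^ ((up_log 2 n).*2 + 3))%N.
Proof.
rewrite expnD mulnC leq_mul // -size_wedges (leq_trans (size_wedges_le G)) //.
by rewrite -muln2 expnM leq_exp2r // up_logP.
Qed.

Theorem transmissions_competitive :
  feasible G Q (output_schedule (transmissions G Q)) /\
  cost G (output_schedule (transmissions G Q)) <= ratio n * opt G Q.
Proof.
have [H [feas le HH pH]] := transmissions_inv; split=> //.
have r0 : 0 < ratio n by rewrite ltr0n addn_gt0 orbT.
(* [opt] is an infimum, so each feasible schedule is bounded separately; the schedule of the
   algorithm shows that there is one. *)
rewrite -ler_pdivrMl //; apply: lb_le_inf.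
  by eexists; exists (output_schedule (transmissions G Q)).
move=> _ [S feasS <-]; rewrite ler_pdivrMl //.
have := sum_levels_le HH pH card_edges_le feasS => le2.
apply: le_trans le _; move: le2.
have -> : ratio n = 9 * ((up_log 2 n).*2 + 3 + 2)%:R.
  by rewrite -natrM /ratio; congr (_%:R); rewrite -addnA mulnDr.
rewrite -[X in 4 * X]mulr_natr; move: (\sum_(s <- H) _) => s.
move: ((_ + 3 + 2)%:R) (cost G S) => a b h; rewrite -[leRHS]mulrA (mulrC a).
by move: (b * a) h => c h; lra.
Qed.

End Competitive.

(** * Dependence on the past only *)

Section Online.
Variables (R : realType) (n : nat) (G : wgraph R n) (t : R).
Local Notation V := 'I_n.
Local Notation request := (request R n).
Local Notation pending := (pending R n).
Local Notation astate := (astate R n).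

Let gE := wedges G.

Definition early (out : seq (R * seq (V * V))) := [seq x <- out | x.1 <= t].

Definition late (st : astate) : bool :=
  all (fun x => t < deadline x.1) st.1 &&
  all (fun q => (t < release q) && (release q <= deadline q)) st.2.1.

Lemma service_sub L (pend : seq pending) y :
  y \in (service gE L pend).2.2 -> y.1 \in map fst pend.
Proof.
rewrite /service; elim/last_ind: pend y => [|pend p IH] y //.
rewrite foldl_rcons map_rcons mem_rcons inE; move: (foldl _ _ _) IH => a IH.
have old : y \in a.2.2 -> (y.1 == p.1) || (y.1 \in map fst pend).
  by move=> /IH ->; rewrite orbT.
rewrite /svcstep; do 2?case: ifP => _ //=; rewrite inE => /predU1P[->|//] /=;
  by rewrite eqxx.
Qed.

(** Services take place at deadlines of pending requests, and a request released after [t] has its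
    deadline after [t]. *)
Lemma late_step st : late st ->
  late (astep gE st) /\ early (astep gE st).2.2 = early st.2.2.
Proof.
case: st => pend [fut out]; rewrite /late /= => /andP[lp lf].
rewrite /astep; case: ifP => rn.
  case: fut rn lf => // q fut rn /= /andP[/andP[tq rq] lf]; split=> //.
  rewrite lf andbT (perm_all _ (perm_insert _ _)) /= lp andbT.
  exact: lt_le_trans tq rq.
case: pend lp {rn} => [|h pend] lp; first by rewrite /serve_first /= lf.
rewrite /serve_first /= lf andbT; split.
  apply/allP => y; rewrite mem_rev => /service_sub /mapP[x xp ->].
  exact: (allP lp).
by rewrite /early /=; move: lp => /= /andP[]; rewrite ltNge => /negbTE->.
Qed.

(* [st] and [st'] run on the same requests up to time [t]; [st] alone sees the
   later requests [S]. *)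
Definition in_step (S : seq request) (st st' : astate) : Prop :=
  (exists pend fut out, st = (pend, (fut ++ S, out)) /\ st' = (pend, (fut, out)))
  \/ [/\ late st, late st' & early st.2.2 = early st'.2.2].

(** While a common request is still to be released, or the first deadline is at most [t], both runs
    make the same choice, since [S] comes after [t]. Otherwise, unless [S] is empty, the order of
    [pend] puts all deadlines after [t] and both runs are late. *)
Lemma in_step_astep S st st' :
  all (fun q => (t < release q) && (release q <= deadline q)) S ->
  pairwise (@by_deadline R n) st'.1 ->
  in_step S st st' -> in_step S (astep gE st) (astep gE st').
Proof.
move=> lS srt [[pend [fut [out [-> Est']]]]|[l l' E]]; last first.
  right; have [l1 e1] := late_step l; have [l2 e2] := late_step l'.
  by split=> //; rewrite e1 e2.
move: srt; rewrite {}Est' => srt; rewrite [(pend, _).1]/= in srt.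
case: fut => [|q fut]; last first.
  left; rewrite /astep /= /release_next /=.
  set x := (q, wcost (forest gE 0 [:: q.1])).
  case: pend {srt} => [|h pend]; first by exists (insert x [::]), fut, out.
  case: ifP => _; first by exists (insert x (h :: pend)), fut, out.
  by rewrite /serve_first /=; eexists; exists (q :: fut); eexists.
case: S lS => [|s S] lS /=.
  by left; move: (astep _ _) => [pend' [fut' out']]; exists pend', fut', out'; rewrite cats0.
have late_case : all (fun x : pending => t < deadline x.1) pend ->
    in_step (s :: S) (astep gE (pend, (s :: S, out))) (astep gE (pend, ([::], out))).
  move=> lp; right.
  have [|l1 e1] := late_step (st := (pend, (s :: S, out))); first by rewrite /late lp.
  have [|l2 e2] := late_step (st := (pend, ([::], out))); first by rewrite /late lp.
  by split=> //; rewrite e1 e2.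
case: pend srt late_case => [|h pend] srt late_case; first exact: late_case.
case: (lerP (deadline h.1) t) => ht.
  left; rewrite /astep /release_next /=.
  have -> : (release s <= deadline h.1) = false.
    apply/negbTE; rewrite -ltNge (le_lt_trans ht) //.
    by move: lS => /= /andP[/andP[]].
  by rewrite /serve_first /=; eexists; exists [::]; eexists.
apply: late_case; rewrite /= ht; apply/allP => x xp; apply: lt_le_trans ht _.
by move: srt => /= /andP[/allP H _]; apply: H.
Qed.

Lemma sorted_release_split (Q : seq request) :
  sorted (fun q q' => release q <= release q') Q ->
  Q = [seq q <- Q | release q <= t] ++ [seq q <- Q | t < release q].
Proof.
rewrite sorted_pairwise => [|x y z]; last exact: le_trans.
elim: Q => //= q Q IH /andP[/allP qQ /IH E].
case: lerP => tq; first by rewrite cat_cons -E.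
have allQ q' : q' \in Q -> t < release q' by move=> /qQ; apply: lt_le_trans.
have -> : [seq q <- Q | release q <= t] = [::].
  rewrite -(filter_pred0 Q); apply: eq_in_filter => q' /allQ.
  by rewrite ltNge => /negbTE.
by congr (_ :: _); rewrite -[LHS]filter_predT; apply: eq_in_filter => q' /allQ.
Qed.

Lemma transmissions_prefix (Q : seq request) : valid_input G Q ->
  early (transmissions G Q) =
  early (transmissions G [seq q <- Q | release q <= t]).
Proof.
move=> vQ; have /andP[srtQ allQ] := vQ.
set P := [seq _ <- _ | _]; set S := [seq q <- Q | t < release q].
have EQ : Q = P ++ S := sorted_release_split srtQ.
have vP : valid_input G P.
  rewrite /valid_input sorted_filter => [|x y z|]; [|exact: le_trans|exact: srtQ].
  by apply/allP => q; rewrite mem_filter => /andP[_ /(allP allQ)].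
have lS : all (fun q => (t < release q) && (release q <= deadline q)) S.
  apply/allP => q; rewrite mem_filter => /andP[-> /(allP allQ)] /andP[->].
  by [].
have sim k : in_step S (iter k (astep gE) ([::], (Q, [::])))
    (iter k (astep gE) ([::], (P, [::]))).
  elim: k => [|k IH]; first by left; exists [::], P, [::]; rewrite /= -EQ.
  rewrite !iterS; apply: in_step_astep => //.
  have [H] := inv_iter vP k; rewrite -/gE.
  by case: (iter _ _ _) => pend [fut out] [].
have := sim (size Q).*2; rewrite -runE.
(* The run on [P] is complete after [(size P).*2] steps and then stands still, so both runs can be
   given the same number of steps. *)
have -> : iter (size Q).*2 (astep gE) ([::], (P, [::])) = run gE P.
  have -> : (size Q).*2 = ((size Q).*2 - (size P).*2 + (size P).*2)%N.
    by rewrite subnK // leq_double EQ size_cat leq_addr.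
  rewrite iterD -runE; have [out ->] := run_done vP.
  by elim: (_ - _)%N => //= k ->.
rewrite /transmissions /early !filter_rev -/gE => sm; congr rev.
by case: sm => [[pend [fut [out [-> ->]]]]|[]].
Qed.

End Online.

Definition steiner_algorithm (R : realType) : algorithm R :=
  fun n G Q => output_schedule (transmissions G Q).

Lemma steiner_algorithm_online (R : realType) : online (@steiner_algorithm R).
Proof.
move=> n G Q Q' t vQ vQ' E; rewrite /steiner_algorithm /output_schedule.
rewrite !filter_map; congr map.
by have := transmissions_prefix t vQ; rewrite E -transmissions_prefix.
Qed.

(** * A functional language for the machine *)

(* A first-order language with a single value as environment; its only loops
   are folds over lists. *)
Inductive tm : Type :=
| Ret of expr
| Let of tm & tm
| Cond of expr & tm & tm
| Call of expr & tm
| Fold of expr & expr & tm.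

(* The environment is in variable 0; variable 1 is a stack of saved ones. *)
Fixpoint compile (t : tm) : cmd :=
  match t with
  | Ret a => Assign 0 a
  | Let t1 t2 =>
      Seq (Assign 1 (EPair (Var 0) (Var 1)))
     (Seq (compile t1)
     (Seq (Assign 0 (EPair (Var 0) (EFst (Var 1))))
     (Seq (Assign 1 (ESnd (Var 1)))
          (compile t2))))
  | Cond a t1 t2 => If a (compile t1) (compile t2)
  | Call a t => Seq (Assign 0 a) (compile t)
  | Fold al ai t =>
      Seq (Assign 0 (EPair al (EPair ai (Var 0))))
     (Seq (While (EFst (Var 0))
             (Seq (Assign 1 (EPair (Var 0) (Var 1)))
             (Seq (Assign 0 (EPair (EFst (EFst (Var 0))) (ESnd (Var 0))))
             (Seq (compile t)
             (Seq (Assign 0 (EPair (ESnd (EFst (EFst (Var 1))))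
                     (EPair (Var 0) (ESnd (ESnd (EFst (Var 1)))))))
                  (Assign 1 (ESnd (Var 1))))))))
          (Assign 0 (EFst (ESnd (Var 0)))))
  end.

(** Expressions may read the environment but not the stack in variable 1, so their values depend on
    the environment alone. *)
Fixpoint closed (a : expr) : bool :=
  match a with
  | Var x => x == 0
  | ENil | EOne => true
  | EFst a1 | ESnd a1 | EHalf a1 => closed a1
  | EPair a1 a2 | EAdd a1 a2 | ESub a1 a2 | ELe a1 a2 => closed a1 && closed a2
  end.

Fixpoint wf (t : tm) : bool :=
  match t with
  | Ret a => closed a
  | Let t1 t2 => wf t1 && wf t2
  | Cond a t1 t2 => [&& closed a, wf t1 & wf t2]
  | Call a t1 => closed a && wf t1
  | Fold al ai t1 => [&& closed al, closed ai & wf t1]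
  end.

(* A bound on the time if every fold is over a list of length at most [B] *)
Fixpoint tbound (B : nat) (t : tm) : nat :=
  match t with
  | Ret a => (eval_time a).+1
  | Let t1 t2 => tbound B t1 + tbound B t2 + 12
  | Cond a t1 t2 => eval_time a + tbound B t1 + tbound B t2 + 1
  | Call a t1 => eval_time a + tbound B t1 + 1
  | Fold al ai t1 => eval_time al + eval_time ai + B * (tbound B t1 + 40) + 40
  end.

Lemma tbound_poly (f : {poly nat}) t :
  exists p : {poly nat}, forall x : nat, tbound f.[x] t = p.[x].
Proof.
elim: t => [a|t1 [p1 h1] t2 [p2 h2]|a t1 [p1 h1] t2 [p2 h2]|a t1 [p1 h1]|al ai t1 [p1 h1]] /=.
- by exists ((eval_time a).+1)%:P => x; rewrite hornerC.
- by exists (p1 + p2 + 12%:P) => x; rewrite !hornerD hornerC h1 h2.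
- exists ((eval_time a)%:P + p1 + p2 + 1%:P) => x.
  by rewrite !hornerD !hornerC h1 h2.
- by exists ((eval_time a)%:P + p1 + 1%:P) => x; rewrite !hornerD !hornerC h1.
- exists ((eval_time al)%:P + (eval_time ai)%:P + f * (p1 + 40%:P) + 40%:P) => x.
  by rewrite !(hornerD, hornerM, hornerC) h1.
Qed.

Section Evaluation.
Variables (R : realType) (B : nat).
Local Notation value := (value R).

Definition regs (v stk : value) : store R :=
  update (update (fun=> Defs.Nil) 1 stk) 0 v.

Definition evl (a : expr) (v : value) : value := Defs.eval (regs v Defs.Nil) a.

Fixpoint fold_rel (P : value -> value -> value -> Prop) (xs : seq value)
    (acc w : value) : Prop :=
  if xs is x :: xs' then exists2 acc', P x acc acc' & fold_rel P xs' acc' w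
  else w = acc.

(** A fold over more than [B] elements has no value: deriving [ev] thereby includes the length
    bounds on which [tbound] relies. *)
Fixpoint ev (t : tm) (v w : value) : Prop :=
  match t with
  | Ret a => w = evl a v
  | Let t1 t2 => exists2 u, ev t1 v u & ev t2 (Pair u v) w
  | Cond a t1 t2 => if truthy (evl a v) then ev t1 v w else ev t2 v w
  | Call a t1 => ev t1 (evl a v) w
  | Fold al ai t1 => exists xs,
      [/\ evl al v = enc_list xs, (size xs <= B)%N
        & fold_rel (fun x acc acc' => ev t1 (Pair x (Pair acc v)) acc')
            xs (evl ai v) w]
  end.

Lemma update_regs0 v stk w : update (regs v stk) 0 w = regs w stk.
Proof. by apply/funext => -[|[|x]]. Qed.

Lemma update_regs1 v stk stk' : update (regs v stk) 1 stk' = regs v stk'.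
Proof. by apply/funext => -[|[|x]]. Qed.

Lemma eval_regs a v stk : closed a -> Defs.eval (regs v stk) a = evl a v.
Proof.
elim: a => [x|||a1 IH1 a2 IH2|a IH|a IH|a1 IH1 a2 IH2|a1 IH1 a2 IH2|a IH|a1 IH1 a2 IH2] //=;
  try by [move=> /eqP-> | move=> /IH; rewrite /evl /= => ->
         | move=> /andP[/IH1 h1 /IH2 h2]; rewrite /evl /= h1 h2].
Qed.

Lemma exec_assign0 v stk a T : T = (eval_time a).+1 ->
  exec (Assign 0 a) (regs v stk) T (regs (Defs.eval (regs v stk) a) stk).
Proof. by move=> ->; rewrite -[X in exec _ _ _ X](update_regs0 v); constructor. Qed.

Lemma exec_assign1 v stk a T : T = (eval_time a).+1 ->
  exec (Assign 1 a) (regs v stk) T (regs v (Defs.eval (regs v stk) a)).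
Proof. by move=> ->; rewrite -[X in exec _ _ _ X](update_regs1 v stk); constructor. Qed.

(** The stack is arbitrary and is restored at the end, which lets the induction pass through the
    code that saves an environment. *)
Lemma compileP t v w stk : wf t -> ev t v w ->
  exists2 T, (T <= tbound B t)%N & exec (compile t) (regs v stk) T (regs w stk).
Proof.
elim: t v w stk => [a|t1 IH1 t2 IH2|a t1 IH1 t2 IH2|a t1 IH1|al ai t1 IH1] v w stk /=.
- move=> ca ->; rewrite -(eval_regs _ stk ca).
  by exists (eval_time a).+1 => //; apply: exec_assign0.
- move=> /andP[w1 w2] [u e1 e2].
  have [T1 le1 x1] := IH1 _ _ (Pair v stk) w1 e1.
  have [T2 le2 x2] := IH2 _ _ stk w2 e2.
  (* Each number is the cost of one assignment: the evaluation time of its expression plus 1. *)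
  exists (4 + (T1 + (5 + (3 + T2))))%N; first by lia.
  eapply exec_seq; first exact: exec_assign1.
  eapply exec_seq; first exact: x1.
  eapply exec_seq; first exact: exec_assign0.
  by eapply exec_seq; first exact: exec_assign1.
- move=> /and3P[ca w1 w2]; rewrite -(eval_regs _ stk ca).
  case: ifP => E e1.
    have [T le x] := IH1 _ _ stk w1 e1; exists (eval_time a + T).+1; first by lia.
    by constructor; rewrite E.
  have [T le x] := IH2 _ _ stk w2 e1; exists (eval_time a + T).+1; first by lia.
  by constructor; rewrite E.
- move=> /andP[ca w1] e1; have [T le x] := IH1 _ _ stk w1 e1.
  exists ((eval_time a).+1 + T)%N; first by lia.
  eapply exec_seq; first exact: exec_assign0.
  by rewrite (eval_regs _ stk ca).
- move=> /and3P[cl ci w1] [xs [El sz fr]].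
  set c := While _ _; set i := evl ai v in fr.
  have [T le x] : exists2 T, (T <= size xs * (tbound B t1 + 40) + 3)%N &
      exec c (regs (Pair (enc_list xs) (Pair i v)) stk) T
             (regs (Pair Defs.Nil (Pair w v)) stk).
    elim: xs i {El sz} fr => [|x xs IH] acc /=.
      by move=> ->; exists 3%N => //; apply: exec_while_stop.
    move=> [acc' e1 fr]; have [T le xc] := IH _ fr.
    have [T1 le1 x1] := IH1 _ _
      (Pair (Pair (Pair x (enc_list xs)) (Pair acc v)) stk) w1 e1.
    exists (2 + (4 + (7 + (T1 + (12 + 3)))) + T).+1; first by lia.
    apply: exec_while_step => //; last exact: xc.
    eapply exec_seq; first exact: exec_assign1.
    eapply exec_seq; first exact: exec_assign0.
    eapply exec_seq; first exact: x1.
    eapply exec_seq; first exact: exec_assign0.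
    exact: exec_assign1.
  exists (eval_time al + (eval_time ai + 1).+1 + 2 + (T + 4))%N.
    have : (size xs * (tbound B t1 + 40) <= B * (tbound B t1 + 40))%N.
      by rewrite leq_mul2r sz orbT.
    by lia.
  eapply exec_seq; first by apply: exec_assign0; rewrite /=; lia.
  rewrite /= !eval_regs // El; eapply exec_seq; first exact: x.
  exact: exec_assign0.
Qed.

Lemma compile_computes t v w : wf t -> ev t v w ->
  exists2 T, (T <= tbound B t)%N & computes (compile t) v T w.
Proof.
move=> wt et; have [T le x] := compileP Defs.Nil wt et; exists T => //.
exists (regs w Defs.Nil) => //; rewrite (_ : update _ 0 v = regs v Defs.Nil) //.
by apply/funext => -[|[|y]].
Qed.

End Evaluation.

(* Environments are lists of values, the [i]-th being [arg i]; the comment next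
   to the name of a program lists the environment that it expects. *)
Definition arg (i : nat) : expr := EFst (iter i ESnd (Var 0)).
Definition args (l : seq expr) : expr := foldr EPair ENil l.
Definition true_expr : expr := EPair ENil ENil.
Definition zero_expr : expr := ESub EOne EOne.

(** Vertices are numbers, and the machine compares numbers by [<=] only. *)
Definition teq (a b : expr) : tm := Cond (ELe a b) (Ret (ELe b a)) (Ret ENil).

(* The body of the following loops sees the current element in [arg 0], the
   accumulator in [arg 1], and then the outer environment. *)
Definition tcatrev (al ak : expr) : tm := Fold al ak (Ret (EPair (arg 0) (arg 1))).
Definition trev (al : expr) : tm := tcatrev al ENil.
(** A fold builds its result backwards, hence the final [trev]. *)
Definition tmap (al : expr) (t : tm) : tm :=
  Let (Fold al ENil (Let t (Ret (EPair (arg 0) (arg 2))))) (trev (arg 0)).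
Definition tfilter (al : expr) (t : tm) : tm :=
  Let (Fold al ENil
         (Let t (Cond (arg 0) (Ret (EPair (arg 1) (arg 2))) (Ret (arg 2)))))
      (trev (arg 0)).

(** * Evaluation rules *)

Section Rules.
Variables (R : realType) (B : nat).
Local Notation value := (value R).
Local Notation ev := (@ev R B).
Implicit Types (v w : value).

Lemma ev_let t1 t2 v u w : ev t1 v u -> ev t2 (Pair u v) w -> ev (Let t1 t2) v w.
Proof. by exists u. Qed.

Lemma ev_cond a t1 t2 v (b : bool) w : truthy (evl a v) = b ->
  ev (if b then t1 else t2) v w -> ev (Cond a t1 t2) v w.
Proof. by move=> /= ->; case: b. Qed.

Lemma ev_call a t v u w : evl a v = u -> ev t u w -> ev (Call a t) v w.
Proof. by move=> /= ->. Qed.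

(** The invariant [I] supplies what the body requires of the accumulator, in practice bounds on the
    lengths of its lists. *)
Lemma ev_fold (X Y : Type) (encX : X -> value) (encY : Y -> value)
    (I : nat -> Y -> Prop) (f : Y -> X -> Y) al ai t v xs y :
  evl al v = enc_list (map encX xs) -> (size xs <= B)%N ->
  evl ai v = encY y -> I 0%N y ->
  (forall i x y, (i < size xs)%N -> I i y ->
     ev t (Pair (encX x) (Pair (encY y) v)) (encY (f y x)) /\ I i.+1 (f y x)) ->
  ev (Fold al ai t) v (encY (foldl f y xs)).
Proof.
move=> El sz Ei I0 step; exists (map encX xs); rewrite size_map; split=> //.
rewrite Ei {El Ei}; have : (0 + size xs <= size xs)%N by [].
elim: {1 3 4}xs 0%N y I0 {sz} => [|x l IH] i y Ii //= le.
have [|e1 I1] := step i x y _ Ii; first by lia.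
by exists (encY (f y x)) => //; apply: IH I1 _; lia.
Qed.

Lemma foldl_inv (X Y : Type) (I : nat -> Y -> Prop) (f : Y -> X -> Y) xs y :
  I 0%N y -> (forall i x y, (i < size xs)%N -> I i y -> I i.+1 (f y x)) ->
  I (size xs) (foldl f y xs).
Proof.
move=> I0 step.
suff H l i y' : (i + size l <= size xs)%N -> I i y' ->
    I (i + size l)%N (foldl f y' l) by exact: (H xs 0%N).
elim: l i y' => [|x l IH] i y' /= le Ii; first by rewrite addn0.
by rewrite addnS -addSn; apply: IH; [lia|apply: step => //; lia].
Qed.

Lemma ev_fold0 (X Y : Type) (encX : X -> value) (encY : Y -> value)
    (f : Y -> X -> Y) al ai t v xs y :
  evl al v = enc_list (map encX xs) -> (size xs <= B)%N -> evl ai v = encY y ->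
  (forall x y, ev t (Pair (encX x) (Pair (encY y) v)) (encY (f y x))) ->
  ev (Fold al ai t) v (encY (foldl f y xs)).
Proof.
by move=> El sz Ei step; apply: (ev_fold (I := fun _ _ => True)) El sz Ei _ _.
Qed.

Lemma ev_catrev (X : Type) (encX : X -> value) al ak v l k :
  evl al v = enc_list (map encX l) -> (size l <= B)%N ->
  evl ak v = enc_list (map encX k) ->
  ev (tcatrev al ak) v (enc_list (map encX (catrev l k))).
Proof.
move=> El sz Ek.
have -> : catrev l k = foldl (fun a x => x :: a) k l by elim: l k {El sz Ek} => /=.
exact: (ev_fold0 (encX := encX) (encY := fun s => enc_list (map encX s))).
Qed.

Lemma ev_rev (X : Type) (encX : X -> value) al v l :
  evl al v = enc_list (map encX l) -> (size l <= B)%N ->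
  ev (trev al) v (enc_list (map encX (rev l))).
Proof. by move=> El sz; apply: ev_catrev. Qed.

Lemma ev_map (X Y : Type) (encX : X -> value) (encY : Y -> value) (f : X -> Y)
    al t v l :
  evl al v = enc_list (map encX l) -> (size l <= B)%N ->
  (forall x a, ev t (Pair (encX x) (Pair a v)) (encY (f x))) ->
  ev (tmap al t) v (enc_list (map encY (map f l))).
Proof.
move=> El sz tP; apply: (ev_let (u := enc_list (map encY (rev (map f l))))).
  have -> : rev (map f l) = foldl (fun a x => f x :: a) [::] l.
    rewrite /rev; elim: l [::] {El sz} => //= x l IH a; exact: IH.
  apply: (ev_fold0 (encX := encX) (encY := fun s => enc_list (map encY s))) => // x y.
  by apply: ev_let (tP x _) _.
have := ev_rev (encX := encY) (al := arg 0) (l := rev (map f l))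
  (v := Pair (enc_list (map encY (rev (map f l)))) v) erefl.
by rewrite revK size_rev size_map; apply.
Qed.

Lemma ev_filter (X : Type) (encX : X -> value) (p : pred X) al t v l :
  evl al v = enc_list (map encX l) -> (size l <= B)%N ->
  (forall x a, ev t (Pair (encX x) (Pair a v)) (of_bool R (p x))) ->
  ev (tfilter al t) v (enc_list (map encX [seq x <- l | p x])).
Proof.
move=> El sz tP; apply: (ev_let (u := enc_list (map encX (rev [seq x <- l | p x])))).
  have -> : rev [seq x <- l | p x] = foldl (fun a x => if p x then x :: a else a) [::] l.
    rewrite /rev; elim: l [::] {El sz} => //= x l IH a.
    by case: (p x) => /=; apply: IH.
  apply: (ev_fold0 (encX := encX) (encY := fun s => enc_list (map encX s))) => // x y.
  apply: ev_let (tP x _) _; rewrite /=.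
  by case: (p x).
have := ev_rev (encX := encX) (al := arg 0) (l := rev [seq x <- l | p x])
  (v := Pair (enc_list (map encX (rev [seq x <- l | p x]))) v) erefl.
rewrite revK size_rev; apply.
by rewrite size_filter (leq_trans (count_size _ _) sz).
Qed.

End Rules.

(** * Programs for the primal-dual algorithm *)

Section GraphPrograms.
Variables (R : realType) (n B : nat).
Local Notation value := (value R).
Local Notation ev := (@ev R B).
Local Notation V := 'I_n.
Local Notation wedge := (wedge R n).
Local Notation erec := (erec R n).
Implicit Types (v w : value) (gE F : seq wedge) (ps : seq (V * V)).

Definition encV (x : V) : value := enc_vertex R x.
Definition encP (p : V * V) : value := enc_pair R p.
Definition encW (w : wedge) : value := Pair (encP w.1) (Leaf w.2).
Definition encE (e : erec) : value :=
  Pair (encW e.1) (Pair (Leaf e.2.1) (encP e.2.2)).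
Definition encA (a : erec * (bool * bool)) : value :=
  Pair (encE a.1) (Pair (of_bool R a.2.1) (of_bool R a.2.2)).
Definition encO (o : option (R * erec)) : value :=
  if o is Some b then Pair (Leaf b.1) (encE b.2) else Defs.Nil.
Definition encPs ps : value := enc_list (map encP ps).
Definition encWs F : value := enc_list (map encW F).
Definition encG (st : gwstate R n) : value :=
  Pair (enc_list (map encE st.1)) (Pair (encPs st.2.1) (encWs st.2.2)).

Lemma truthy_of_bool b : truthy (of_bool R b) = b.
Proof. by case: b. Qed.

Lemma ev_eq a b v (x y : V) : evl a v = encV x -> evl b v = encV y ->
  ev (teq a b) v (of_bool R (x == y)).
Proof.
move=> Ea Eb; rewrite /teq /=; rewrite /evl /= in Ea Eb *.
rewrite Ea Eb /= !ler_nat truthy_of_bool.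
rewrite -[x == y]/(val x == val y) eqn_leq.
by case: (x <= y)%N => //=; case: (y <= x)%N.
Qed.

Definition t_act : tm := (* [l; ps] *)
  Fold (arg 1) ENil
    (Cond (arg 1) (Ret (arg 1))
      (Let (teq (EFst (arg 0)) (ESnd (arg 0)))
        (Cond (arg 0) (Ret ENil)
          (Let (teq (EFst (arg 1)) (arg 3))
            (Cond (arg 0) (Ret (arg 0)) (teq (ESnd (arg 2)) (arg 4))))))).

Lemma ev_act l ps (v := Pair (encV l) (Pair (encPs ps) Defs.Nil)) :
  (size ps <= B)%N -> ev t_act v (of_bool R (act ps l)).
Proof.
move=> sz; rewrite /act.
have -> : has (fun p => (p.1 != p.2) && ((p.1 == l) || (p.2 == l))) ps =
    foldl (fun a p => a || (p.1 != p.2) && ((p.1 == l) || (p.2 == l))) false ps.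
  rewrite -[LHS]orFb; elim: ps false {v sz} => [|p ps IH] a /=; first by rewrite orbF.
  by rewrite orbA IH.
apply: (ev_fold0 (encX := encP)) => // p a.
apply: (ev_cond (b := a)); first by rewrite /evl /= truthy_of_bool.
case: a => //; apply: ev_let (ev_eq (x := p.1) (y := p.2) _ _) _ => //.
apply: (ev_cond (b := p.1 == p.2)); first by rewrite /evl /= truthy_of_bool.
case: ifP => // _; apply: ev_let (ev_eq (x := p.1) (y := l) _ _) _ => //.
apply: (ev_cond (b := p.1 == l)); first by rewrite /evl /= truthy_of_bool.
by case: ifP => // _; apply: ev_eq.
Qed.

Definition t_flags : tm := (* [q; ps] *)
  Let (teq (EFst (arg 0)) (ESnd (arg 0)))
    (Cond (arg 0) (Ret (EPair ENil ENil))
      (Let (Call (args [:: EFst (arg 1); arg 2]) t_act)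
        (Let (Call (args [:: ESnd (arg 2); arg 3]) t_act)
          (Ret (EPair (arg 1) (arg 0)))))).

Definition encF (f : bool * bool) : value := Pair (of_bool R f.1) (of_bool R f.2).

Lemma ev_flags q ps (v := Pair (encP q) (Pair (encPs ps) Defs.Nil)) :
  (size ps <= B)%N -> ev t_flags v (encF (flags ps q)).
Proof.
move=> sz; apply: ev_let (ev_eq (x := q.1) (y := q.2) _ _) _ => //.
apply: (ev_cond (b := q.1 == q.2)); first by rewrite /evl /= truthy_of_bool.
rewrite /flags; case: ifP => // _.
apply: ev_let; first exact: ev_act sz.
by apply: ev_let; first exact: ev_act sz.
Qed.

Definition t_annot : tm := (* [ps; es] *)
  tmap (arg 1) (Let (Call (args [:: ESnd (ESnd (arg 0)); arg 2]) t_flags)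
                    (Ret (EPair (arg 1) (arg 0)))).

Lemma ev_annot ps (es : seq erec)
    (v := Pair (encPs ps) (Pair (enc_list (map encE es)) Defs.Nil)) :
  (size ps <= B)%N -> (size es <= B)%N ->
  ev t_annot v (enc_list (map encA (annot ps es))).
Proof.
move=> szp sze; apply: (ev_map (encX := encE)) => // e a.
by apply: ev_let; first exact: (ev_flags e.2.2 szp).
Qed.

Definition t_best : tm := (* [a; acc] *)
  Let (Cond (EFst (ESnd (arg 0))) (Ret (EFst (ESnd (arg 0))))
            (Ret (ESnd (ESnd (arg 0)))))
    (Cond (arg 0)
      (Let (Cond (EFst (ESnd (arg 1)))
             (Cond (ESnd (ESnd (arg 1)))
                (Ret (EHalf (EFst (ESnd (EFst (arg 1))))))
                (Ret (EFst (ESnd (EFst (arg 1))))))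
             (Ret (EFst (ESnd (EFst (arg 1))))))
        (Cond (arg 3)
          (Cond (ELe (EFst (arg 3)) (arg 0)) (Ret (arg 3))
             (Ret (EPair (arg 0) (EFst (arg 2)))))
          (Ret (EPair (arg 0) (EFst (arg 2))))))
      (Ret (arg 2))).

Lemma ev_best a acc (v := Pair (encA a) (Pair (encO acc) Defs.Nil)) :
  ev t_best v (encO (best acc a)).
Proof.
apply: (ev_let (u := of_bool R (a.2.1 || a.2.2))).
  by rewrite /= /evl /=; case: a.2.1.
apply: (ev_cond (b := a.2.1 || a.2.2)); first by rewrite /evl /= truthy_of_bool.
rewrite /best; case: ifP => // _; apply: (ev_let (u := Leaf (tight_time a))).
  by rewrite /tight_time /= /evl /=; case: a.2.1; case: a.2.2.
case: acc @v => [b|] //=; rewrite /evl /= truthy_of_bool.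
by case: (b.1 <= _).
Qed.

Definition t_relab2 : tm := (* [p; q] *)
  Let (teq (EFst (arg 0)) (EFst (arg 1)))
    (Let (Cond (arg 0) (Ret (ESnd (arg 2))) (Ret (EFst (arg 1))))
      (Let (teq (ESnd (arg 2)) (EFst (arg 3)))
        (Let (Cond (arg 0) (Ret (ESnd (arg 4))) (Ret (ESnd (arg 3))))
          (Ret (EPair (arg 2) (arg 0)))))).

Lemma ev_relab2 p q (v := Pair (encP p) (Pair (encP q) Defs.Nil)) :
  ev t_relab2 v (encP (relab2 q.1 q.2 p)).
Proof.
apply: ev_let (ev_eq (x := p.1) (y := q.1) _ _) _ => //.
apply: (ev_let (u := encV (relab q.1 q.2 p.1))).
  by rewrite /relab /= /evl /=; case: eqP.
apply: ev_let (ev_eq (x := p.2) (y := q.1) _ _) _ => //.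
apply: (ev_let (u := encV (relab q.1 q.2 p.2))) => //.
by rewrite /relab /= /evl /=; case: eqP.
Qed.

Definition t_upd : tm := (* [a; d; q] *)
  Let (Cond (EFst (ESnd (arg 0)))
         (Ret (ESub (EFst (ESnd (EFst (arg 0)))) (arg 1)))
         (Ret (EFst (ESnd (EFst (arg 0))))))
    (Let (Cond (ESnd (ESnd (arg 1))) (Ret (ESub (arg 0) (arg 2))) (Ret (arg 0)))
      (Let (Call (args [:: ESnd (ESnd (EFst (arg 2))); arg 4]) t_relab2)
        (Ret (EPair (EFst (EFst (arg 3))) (EPair (arg 1) (arg 0)))))).

Lemma ev_upd a d q (v := Pair (encA a) (Pair (Leaf d) (Pair (encP q) Defs.Nil))) :
  ev t_upd v (encE (gwupd d q a)).
Proof.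
apply: (ev_let (u := Leaf (a.1.2.1 - (if a.2.1 then d else 0)))).
  by rewrite /= /evl /=; case: a.2.1; rewrite ?subr0.
apply: (ev_let (u := Leaf (gwupd d q a).2.1)).
  by rewrite /= /evl /=; case: a.2.2; rewrite ?subr0.
by apply: ev_let; first exact: (ev_relab2 a.1.2.2 q).
Qed.

Definition t_step : tm := (* [es; ps; F] *)
  Let (Call (args [:: arg 1; arg 0]) t_annot)
    (Let (Fold (arg 0) ENil (Call (args [:: arg 0; arg 1]) t_best))
      (Cond (arg 0)
        (Let (tmap (arg 1)
               (Call (args [:: arg 0; EFst (arg 2); ESnd (ESnd (ESnd (arg 2)))])
                  t_upd))
          (Let (tmap (arg 4)
                 (Call (args [:: arg 0; ESnd (ESnd (ESnd (arg 3)))]) t_relab2))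
            (Ret (EPair (arg 1)
                   (EPair (arg 0) (EPair (EFst (ESnd (arg 2))) (arg 6)))))))
        (Ret (EPair (arg 2) (EPair (arg 3) (arg 4)))))).

Lemma ev_step (st : gwstate R n)
    (v := Pair (enc_list (map encE st.1))
           (Pair (encPs st.2.1) (Pair (encWs st.2.2) Defs.Nil))) :
  (size st.1 <= B)%N -> (size st.2.1 <= B)%N -> ev t_step v (encG (gwstep st)).
Proof.
move=> sze szp; apply: ev_let; first exact: ev_annot szp sze.
have sza : (size (annot st.2.1 st.1) <= B)%N by rewrite size_map.
apply: ev_let.
  by apply: (ev_fold0 (encX := encA) (encY := encO) (f := @best R n) (y := None) _ sza)
    => // a acc; apply: ev_best.
rewrite /gwstep; case: (foldl _ _ _) => [b|]; last exact: erefl.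
apply: (ev_cond (b := true)) => //; apply: ev_let.
  apply: (ev_map (encX := encA) (encY := encE) (f := gwupd b.1 b.2.2.2) _ sza) => // a acc.
  exact: ev_upd.
apply: ev_let; last exact: erefl.
apply: (ev_map (encX := encP) (encY := encP)
  (f := relab2 b.2.2.2.1 b.2.2.2.2) _ szp) => // p acc.
exact: ev_relab2.
Qed.

Definition t_gwrun : tm := (* [gE; ps] *)
  Let (tmap (arg 0) (Ret (EPair (arg 0) (EPair (ESnd (arg 0)) (EFst (arg 0))))))
    (Let (Fold (arg 1) (EPair (arg 0) (EPair (arg 2) ENil))
           (Call (args [:: EFst (arg 1); EFst (ESnd (arg 1)); ESnd (ESnd (arg 1))])
              t_step))
      (Ret (ESnd (ESnd (arg 0))))).

Lemma gwstep_size (st : gwstate R n) :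
  [/\ size (gwstep st).1 = size st.1, size (gwstep st).2.1 = size st.2.1
    & (size (gwstep st).2.2 <= (size st.2.2).+1)%N].
Proof.
rewrite /gwstep; case: (foldl _ _ _) => [b|] //=.
by rewrite /annot !size_map.
Qed.

Lemma ev_gwrun gE ps (v := Pair (encWs gE) (Pair (encPs ps) Defs.Nil)) :
  (size gE <= B)%N -> (size ps <= B)%N -> ev t_gwrun v (encWs (gwrun gE ps)).
Proof.
move=> szg szp; apply: ev_let.
  by apply: (ev_map (encX := encW) (encY := encE) (f := fun x => (x, (x.2, x.1))) _ szg).
apply: (ev_let (u := encG (foldl (fun st _ => gwstep st)
  (gwinit gE, (ps, [::])) gE))); last exact: erefl.
apply: (ev_fold (encX := encW) (encY := encG)
  (I := fun _ st => size st.1 = size gE /\ size st.2.1 = size ps)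
  (f := fun st _ => gwstep st) (y := (gwinit gE, (ps, [::]))) _ szg) => //.
  by rewrite size_map.
move=> i w st _ [s1 s2]; have [-> -> _] := gwstep_size st; split=> //.
by apply: ev_step; rewrite ?s1 ?s2.
Qed.

Lemma size_gwrun gE ps : (size (gwrun gE ps) <= size gE)%N.
Proof.
rewrite /gwrun.
apply: (foldl_inv (I := fun i (st : gwstate R n) => (size st.2.2 <= i)%N)) => // i w st _ le.
by have [_ _ le'] := gwstep_size st; lia.
Qed.

Definition t_conn : tm := (* [es; ps] *)
  Let (Fold (arg 0) (EPair (arg 0) (arg 1))
        (Cond (EFst (arg 1))
          (Let (tmap (ESnd (EFst (arg 1)))
                 (Call (args [:: arg 0; EFst (EFst (arg 3))]) t_relab2))
            (Let (tmap (ESnd (arg 2))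
                   (Call (args [:: arg 0; EFst (EFst (arg 4))]) t_relab2))
              (Ret (EPair (arg 1) (arg 0)))))
          (Ret (arg 1))))
    (Fold (ESnd (arg 0)) true_expr
      (Cond (arg 1) (teq (EFst (arg 0)) (ESnd (arg 0))) (Ret ENil))).

Definition encC (st : seq (V * V) * seq (V * V)) : value :=
  Pair (encPs st.1) (encPs st.2).

Lemma ev_conn es ps (v := Pair (encPs es) (Pair (encPs ps) Defs.Nil)) :
  (size es <= B)%N -> (size ps <= B)%N -> ev t_conn v (of_bool R (conn es ps)).
Proof.
move=> sze szp; pose f (st : seq (V * V) * seq (V * V)) (_ : V * V) := cstep st.
have stepI i p st : (i < size es)%N ->
    (size st.1 <= B)%N /\ size st.2 = size ps ->
    (size (f st p).1 <= B)%N /\ size (f st p).2 = size ps.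
  by case: st => [[|q l] k] _ //= [le <-]; rewrite /f /cstep /= !size_map ltnW.
have [_ szk] : (size (foldl f (es, ps) es).1 <= B)%N /\
    size (foldl f (es, ps) es).2 = size ps.
  by apply: (foldl_inv (I := fun _ st => (size st.1 <= B)%N /\ size st.2 = size ps))
    => // i p st; apply: stepI.
apply: ev_let.
  apply: (ev_fold (encX := encP) (encY := encC)
    (I := fun _ st => (size st.1 <= B)%N /\ size st.2 = size ps)
    (f := f) (y := (es, ps)) _ sze) => // i p st lt Ist.
  split; last exact: stepI lt Ist.
  case: st Ist => [[|q l] k] [le lek] //.
  apply: (ev_cond (b := true)) => //; apply: ev_let.
    apply: (ev_map (encX := encP) (encY := encP) (f := relab2 q.1 q.2) _ (ltnW le)) => // x a.
    exact: ev_relab2.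
  apply: ev_let.
    apply: (ev_map (encX := encP) (encY := encP) (f := relab2 q.1 q.2) (l := k)) => //.
      by rewrite lek.
    by move=> x a; apply: ev_relab2.
  exact: erefl.
rewrite /conn -/f; move: (foldl _ _ _) szk => st szl.
have -> : all (fun p => p.1 == p.2) st.2 =
    foldl (fun a (p : V * V) => a && (p.1 == p.2)) true st.2.
  rewrite -[LHS]andTb; elim: st.2 true {szl} => [|p l IH] a /=; first by rewrite andbT.
  by rewrite andbA IH.
apply: (ev_fold0 (encX := encP)); rewrite ?szl //.
move=> p a; apply: (ev_cond (b := a)); first by rewrite /evl /= truthy_of_bool.
by case: a => //; apply: (ev_eq (x := p.1) (y := p.2)).
Qed.

Definition t_prune : tm := (* [ps; F] *)
  Let (Fold (arg 1) (EPair (arg 1) ENil)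
        (Cond (EFst (arg 1))
          (Let (tcatrev (ESnd (EFst (arg 1))) (ESnd (arg 1)))
            (Let (tmap (arg 0) (Ret (EFst (arg 0))))
              (Let (Call (args [:: arg 0; arg 4]) t_conn)
                (Cond (arg 0)
                  (Ret (EPair (ESnd (EFst (arg 4))) (ESnd (arg 4))))
                  (Ret (EPair (ESnd (EFst (arg 4)))
                         (EPair (EFst (EFst (arg 4))) (ESnd (arg 4)))))))))
          (Ret (arg 1))))
    (Ret (ESnd (arg 0))).

Definition encFF (st : seq wedge * seq wedge) : value :=
  Pair (encWs st.1) (encWs st.2).

Lemma pstep_size ps (st : seq wedge * seq wedge) :
  (size (pstep ps st).1 + size (pstep ps st).2 <= size st.1 + size st.2)%N.
Proof.
case: st => [[|w l] k] //; rewrite /pstep /=; case: ifP => _ /=; lia.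
Qed.

Lemma size_prune ps F : (size (prune ps F) <= size F)%N.
Proof.
rewrite /prune.
have : (size (foldl (fun st (_ : wedge) => pstep ps st) (F, [::]) F).1 +
    size (foldl (fun st (_ : wedge) => pstep ps st) (F, [::]) F).2 <= size F)%N.
  apply: (foldl_inv (I := fun _ (st : seq wedge * seq wedge) =>
    (size st.1 + size st.2 <= size F)%N)) => [|i w st _ le].
    by rewrite addn0.
  exact: leq_trans (pstep_size ps st) le.
by lia.
Qed.

Lemma ev_prune ps F (v := Pair (encPs ps) (Pair (encWs F) Defs.Nil)) :
  (size ps <= B)%N -> (size F <= B)%N -> ev t_prune v (encWs (prune ps F)).
Proof.
move=> szp szF; apply: (ev_let (u := encFF (foldl (fun st _ => pstep ps st) (F, [::]) F)));
  last exact: erefl.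
apply: (ev_fold (encX := encW) (encY := encFF)
    (I := fun _ st => (size st.1 + size st.2 <= size F)%N)
    (f := fun st _ => pstep ps st) (y := (F, [::])) _ szF) => //.
  by rewrite addn0.
move=> i w st _ Ist; split; last exact: leq_trans (pstep_size ps st) Ist.
case: st Ist => [[|u l] k] // Ist; rewrite /= in Ist.
apply: (ev_cond (b := true)) => //; apply: ev_let.
  by apply: (ev_catrev (encX := encW) (l := l) (k := k)) => //; lia.
have szc : (size (catrev l k) <= B)%N by rewrite catrevE size_cat size_rev; lia.
apply: ev_let.
  exact: (ev_map (encX := encW) (encY := encP) (f := fst) _ szc).
apply: ev_let.
  by apply: (ev_conn (es := map fst (catrev l k)) _ szp); rewrite size_map.
apply: (ev_cond (b := conn (map fst (catrev l k)) ps)).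
  by rewrite /evl /= truthy_of_bool.
by rewrite /pstep /=; case: ifP.
Qed.

Definition t_sforest : tm := (* [gE; ps] *)
  Let (Call (args [:: arg 0; arg 1]) t_gwrun)
    (Call (args [:: arg 2; arg 0]) t_prune).

Lemma ev_sforest gE ps (v := Pair (encWs gE) (Pair (encPs ps) Defs.Nil)) :
  (size gE <= B)%N -> (size ps <= B)%N -> ev t_sforest v (encWs (sforest gE ps)).
Proof.
move=> szg szp; apply: ev_let; first exact: ev_gwrun szg szp.
by apply: ev_prune szp _; apply: leq_trans (size_gwrun gE ps) szg.
Qed.

Lemma size_sforest gE ps : (size (sforest gE ps) <= size gE)%N.
Proof. exact: leq_trans (size_prune _ _) (size_gwrun _ _). Qed.

End GraphPrograms.

(** * The program *)

Section AlgorithmPrograms.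
Variables (R : realType) (n B : nat).
Local Notation value := (value R).
Local Notation ev := (@ev R B).
Local Notation V := 'I_n.
Local Notation wedge := (wedge R n).
Local Notation pending := (pending R n).
Local Notation encW := (@encW R n).
Local Notation encP := (@encP R n).
Local Notation encPs := (@encPs R n).
Local Notation encWs := (@encWs R n).
Implicit Types (v : value) (gE F : seq wedge) (ps : seq (V * V)) (L : R).

Definition t_scaled : tm := (* [w; gE] *)
  Fold (arg 1) zero_expr
    (Ret (EAdd (arg 1) (EAdd (EAdd (ESnd (arg 2)) (ESnd (arg 2)))
                             (EAdd (ESnd (arg 2)) (ESnd (arg 2)))))).

Lemma ev_scaled gE (w : wedge) (v := Pair (encW w) (Pair (encWs gE) Defs.Nil)) :
  (size gE <= B)%N -> ev t_scaled v (Leaf (scaled gE w)).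
Proof.
move=> sz; apply: (ev_fold0 (encX := encW) (encY := @Leaf R) _ sz) => //.
by rewrite /evl /= subrr.
Qed.

Definition t_discount : tm := (* [gE; L] *)
  tmap (arg 0)
    (Let (Call (args [:: arg 0; arg 2]) t_scaled)
      (Cond (ELe (arg 0) (arg 4)) (Ret (EPair (EFst (arg 1)) zero_expr))
         (Ret (arg 1)))).

Lemma ev_discount gE L (v := Pair (encWs gE) (Pair (Leaf L) Defs.Nil)) :
  (size gE <= B)%N -> ev t_discount v (encWs (discount gE L)).
Proof.
move=> sz; apply: (ev_map (encX := encW) (encY := encW) _ sz) => // w a.
apply: ev_let; first exact: ev_scaled sz.
apply: (ev_cond (b := scaled gE w <= L)); first by rewrite /evl /= truthy_of_bool.
by case: ifP => _; rewrite /= /evl /= ?subrr.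
Qed.

Definition t_forest : tm := (* [gE; L; ps] *)
  Let (Call (args [:: arg 0; arg 1]) t_discount)
    (Call (args [:: arg 0; arg 3]) t_sforest).

Lemma ev_forest gE L ps
    (v := Pair (encWs gE) (Pair (Leaf L) (Pair (encPs ps) Defs.Nil))) :
  (size gE <= B)%N -> (size ps <= B)%N -> ev t_forest v (encWs (forest gE L ps)).
Proof.
move=> szg szp; apply: ev_let; first exact: ev_discount szg.
by apply: ev_sforest; rewrite ?size_map.
Qed.

Lemma size_forest gE L ps : (size (forest gE L ps) <= size gE)%N.
Proof. by rewrite (leq_trans (size_sforest _ _)) // size_map. Qed.

Definition t_wcost : tm := (* [F] *)
  Fold (arg 0) zero_expr (Ret (EAdd (arg 1) (ESnd (arg 0)))).

Lemma ev_wcost F (v := Pair (encWs F) Defs.Nil) :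
  (size F <= B)%N -> ev t_wcost v (Leaf (wcost F)).
Proof.
move=> sz; apply: (ev_fold0 (encX := encW) (encY := @Leaf R) _ sz) => //.
by rewrite /evl /= subrr.
Qed.

Definition encQ (p : pending) : value := Pair (enc_request p.1) (Leaf p.2).
Definition encQs (s : seq pending) : value := enc_list (map encQ s).
Definition encS (a : seq (V * V) * (seq wedge * seq pending)) : value :=
  Pair (encPs a.1) (Pair (encWs a.2.1) (encQs a.2.2)).

Definition t_svcstep : tm := (* [p; acc; gE; L] *)
  Cond (ELe (ESnd (arg 0)) (EAdd (arg 3) (arg 3)))
    (Let (Ret (EPair (EFst (EFst (arg 0))) (EFst (arg 1))))
      (Let (Call (args [:: arg 3; arg 4; arg 0]) t_forest)
        (Let (Call (args [:: arg 0]) t_wcost)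
          (Cond (ELe (arg 0) (EAdd (arg 6) (arg 6)))
            (Ret (EPair (arg 2) (EPair (arg 1) (ESnd (ESnd (arg 4))))))
            (Ret (EPair (EFst (arg 4)) (EPair (EFst (ESnd (arg 4)))
               (EPair (EPair (EFst (arg 3)) (EAdd (arg 6) (arg 6)))
                      (ESnd (ESnd (arg 4)))))))))))
    (Ret (EPair (EFst (arg 1)) (EPair (EFst (ESnd (arg 1)))
       (EPair (arg 0) (ESnd (ESnd (arg 1))))))).

Lemma ev_svcstep gE L acc (p : pending)
    (v := Pair (encQ p) (Pair (encS acc) (Pair (encWs gE)
            (Pair (Leaf L) Defs.Nil)))) :
  (size gE <= B)%N -> (size acc.1 < B)%N ->
  ev t_svcstep v (encS (svcstep gE L acc p)).
Proof.
move=> szg sza; apply: (ev_cond (b := p.2 <= L + L)).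
  by rewrite /evl /= truthy_of_bool.
rewrite /svcstep; case: ifP => // _.
apply: (ev_let (u := encPs (p.1.1 :: acc.1))) => //.
apply: ev_let; first exact: (ev_forest (ps := p.1.1 :: acc.1) L szg sza).
apply: ev_let.
  by apply: ev_wcost; apply: leq_trans (size_forest _ _ _) szg.
apply: (ev_cond (b := wcost (forest gE L (p.1.1 :: acc.1)) <= L + L)).
  by rewrite /evl /= truthy_of_bool.
by case: ifP.
Qed.

Lemma svcstep_size gE L acc (p : pending) :
  [/\ (size (svcstep gE L acc p).1 <= (size acc.1).+1)%N,
      (size (svcstep gE L acc p).2.1 <= maxn (size gE) (size acc.2.1))%N
    & (size (svcstep gE L acc p).2.2 <= (size acc.2.2).+1)%N].
Proof.
have le := size_forest gE L (p.1.1 :: acc.1).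
by rewrite /svcstep; do 2?case: ifP => _ /=; split; lia.
Qed.

Definition t_service : tm := (* [gE; L; pend] *)
  Fold (arg 2) (EPair ENil (EPair ENil ENil))
    (Call (args [:: arg 0; arg 1; arg 2; arg 3]) t_svcstep).

Lemma ev_service gE L (pend : seq pending)
    (v := Pair (encWs gE) (Pair (Leaf L) (Pair (encQs pend) Defs.Nil))) :
  (size gE <= B)%N -> (size pend <= B)%N ->
  ev t_service v (encS (service gE L pend)).
Proof.
move=> szg szp; apply: (ev_fold (encX := encQ) (encY := encS)
  (I := fun i acc => (size acc.1 <= i)%N) _ szp) => // i p acc lt le.
split; first by apply: ev_svcstep szg _; lia.
by have [le' _ _] := svcstep_size gE L acc p; lia.
Qed.

Lemma service_size gE L (pend : seq pending) :
  (size (service gE L pend).2.1 <= size gE)%N /\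
  (size (service gE L pend).2.2 <= size pend)%N.
Proof.
rewrite /service; apply: (foldl_inv (I := fun i acc =>
  (size acc.2.1 <= size gE)%N /\ (size acc.2.2 <= i)%N)) => // i p acc _ [h1 h2].
by have [_ h3 h4] := svcstep_size gE L acc p; split; lia.
Qed.

Definition release_expr (a : expr) : expr := EFst (ESnd a).
Definition deadline_expr (a : expr) : expr := ESnd (ESnd a).

Definition t_insert : tm := (* [p; s] *)
  Let (tfilter (arg 1)
        (Ret (ELe (deadline_expr (EFst (arg 0))) (deadline_expr (EFst (arg 2))))))
    (Let (tfilter (arg 2)
           (Cond (ELe (deadline_expr (EFst (arg 0))) (deadline_expr (EFst (arg 3))))
              (Ret ENil) (Ret true_expr)))
      (Let (trev (arg 1))
        (tcatrev (arg 0) (EPair (arg 3) (arg 1))))).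

Lemma ev_insert (p : pending) s (v := Pair (encQ p) (Pair (encQs s) Defs.Nil)) :
  (size s <= B)%N -> ev t_insert v (encQs (insert p s)).
Proof.
move=> sz; apply: ev_let.
  by apply: (ev_filter (encX := encQ)
    (p := fun x => deadline x.1 <= deadline p.1) _ sz).
set s1 := [seq x <- s | _].
have sz1 : (size s1 <= B)%N by rewrite size_filter (leq_trans (count_size _ _)).
apply: ev_let.
  apply: (ev_filter (encX := encQ)
    (p := fun x => ~~ (deadline x.1 <= deadline p.1)) _ sz) => // x a.
  apply: (ev_cond (b := deadline x.1 <= deadline p.1)).
    by rewrite /evl /= truthy_of_bool.
  by case: ifP.
set s2 := [seq x <- s | _].
apply: ev_let; first exact: (ev_rev (encX := encQ) _ sz1).
have -> : insert p s = catrev (rev s1) (p :: s2) by rewrite catrevE revK.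
by apply: (ev_catrev (encX := encQ)); rewrite // size_rev.
Qed.

Definition encT (x : R * seq (V * V)) : value := Pair (Leaf x.1) (encPs x.2).
Definition encSt (st : astate R n) : value :=
  Pair (encQs st.1)
    (Pair (enc_list (map (@enc_request R n) st.2.1))
          (enc_list (map encT st.2.2))).

Definition t_astep : tm := (* [pend; fut; out; gE] *)
  Let (Cond (arg 1)
        (Cond (arg 0)
          (Ret (ELe (release_expr (EFst (arg 1)))
                    (deadline_expr (EFst (EFst (arg 0))))))
          (Ret true_expr))
        (Ret ENil))
    (Cond (arg 0)
      (Let (Call (args [:: arg 4; zero_expr; EPair (EFst (EFst (arg 2))) ENil])
              t_forest)
        (Let (Call (args [:: arg 0]) t_wcost)
          (Let (Call (args [:: EPair (EFst (arg 4)) (arg 0); arg 3]) t_insert)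
            (Ret (EPair (arg 0) (EPair (ESnd (arg 5)) (arg 6)))))))
      (Cond (arg 1)
        (Let (Call (args [:: arg 4; ESnd (EFst (arg 1)); arg 1]) t_service)
          (Let (trev (ESnd (ESnd (arg 0))))
            (Let (tmap (EFst (ESnd (arg 1))) (Ret (EFst (arg 0))))
              (Ret (EPair (arg 1) (EPair (arg 5)
                 (EPair (EPair (deadline_expr (EFst (EFst (arg 4)))) (arg 0))
                        (arg 6))))))))
        (Ret (EPair (arg 1) (EPair (arg 2) (arg 3)))))).

Lemma ev_astep gE (st : astate R n)
    (v := Pair (encQs st.1)
            (Pair (enc_list (map (@enc_request R n) st.2.1))
               (Pair (enc_list (map encT st.2.2))
                  (Pair (encWs gE) Defs.Nil)))) :
  (0 < B)%N -> (size gE <= B)%N -> (size st.1 <= B)%N ->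
  ev t_astep v (encSt (astep gE st)).
Proof.
move=> B0 szg; case: st @v => pend [fut out] v szp; rewrite {}/v; rewrite /= in szp.
apply: (ev_let (u := of_bool R (release_next (pend, (fut, out))))).
  by case: fut => [|q fut] //; case: pend {szp} => [|h pend].
apply: (ev_cond (b := release_next (pend, (fut, out)))).
  by rewrite /evl /= truthy_of_bool.
rewrite /astep; case: ifP => rn.
  case: fut rn => // q fut _.
  (* The program writes 0 as [1 - 1], which equals 0 only by a lemma; hence the equation as a
     premise. *)
  have ev_forest0 L : L = 0 -> ev t_forest
      (Pair (encWs gE) (Pair (Leaf L) (Pair (encPs [:: q.1]) Defs.Nil)))
      (encWs (forest gE 0 [:: q.1])) by move=> ->; apply: ev_forest.
  apply: ev_let; first exact: ev_forest0 (subrr 1).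
  apply: ev_let.
    by apply: ev_wcost; apply: leq_trans (size_forest _ _ _) szg.
  apply: ev_let; last exact: erefl.
  exact: (ev_insert (q, wcost (forest gE 0 [:: q.1])) szp).
case: pend {rn} szp => [|h pend] szp //.
have [szF szr] := service_size gE h.2 (h :: pend).
apply: (ev_cond (b := true)) => //; apply: ev_let.
  exact: (ev_service h.2 szg szp).
apply: ev_let.
  by apply: (ev_rev (encX := encQ) (l := (service gE h.2 (h :: pend)).2.2));
    rewrite // (leq_trans szr).
apply: ev_let; last exact: erefl.
by apply: (ev_map (encX := encW) (encY := encP) (f := fst)
  (l := (service gE h.2 (h :: pend)).2.1)); rewrite // (leq_trans szF).
Qed.

End AlgorithmPrograms.

Definition t_main : tm :=
  Call (args [:: ESnd (EFst (Var 0)); ESnd (Var 0)])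
    (Let (Fold (arg 1) (EPair ENil (EPair (arg 1) ENil))
           (Let (Call (args [:: EFst (arg 1); EFst (ESnd (arg 1));
                                ESnd (ESnd (arg 1)); arg 2]) t_astep)
             (Call (args [:: EFst (arg 0); EFst (ESnd (arg 0));
                             ESnd (ESnd (arg 0)); arg 3]) t_astep)))
      (trev (ESnd (ESnd (arg 0))))).

Section MainProgram.
Variables (R : realType) (n : nat).

Lemma astep_size gE (st : astate R n) :
  (size (astep gE st).1 + size (astep gE st).2.1 <= size st.1 + size st.2.1)%N /\
  (size (astep gE st).2.2 <= (size st.2.2).+1)%N.
Proof.
case: st => pend [fut out]; rewrite /astep; case: ifP => rn.
  case: fut rn => // q fut _; rewrite /release_first /=.
  by rewrite (perm_size (perm_insert _ _)) /= addSnnS.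
case: pend {rn} => [|h pend] //; rewrite /serve_first /= size_rev.
by have [_] := service_size gE h.2 (h :: pend); rewrite /= leq_add2r.
Qed.

Lemma ev_main B (G : wgraph R n) Q : (0 < B)%N -> (n ^ 2 <= B)%N ->
  (2 * size Q <= B)%N ->
  @ev R B t_main (enc_input G Q) (enc_output (transmissions G Q)).
Proof.
move=> B0 Bn BQ; set gE := wedges G.
have szg : (size gE <= B)%N by rewrite (leq_trans (size_wedges_le G)).
have szQ : (size Q <= B)%N by lia.
pose v := Pair (encWs gE) (Pair (enc_list (map (@enc_request R n) Q)) Defs.Nil).
apply: (ev_call (u := v)).
  by rewrite /evl /= /v /encWs /gE /wedges -map_comp.
(* Pending and future requests never outnumber [Q], and each of the two steps per iteration adds at
   most one transmission. *)
pose I i (st : astate R n) :=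
  (size st.1 + size st.2.1 <= size Q)%N /\ (size st.2.2 <= i.*2)%N.
pose f (st : astate R n) (_ : request R n) := astep gE (astep gE st).
have stepI i q st : (i < size Q)%N -> I i st -> I i.+1 (f st q).
  move=> _ [h1 h2]; have [h3 h4] := astep_size gE st.
  have [h5 h6] := astep_size gE (astep gE st).
  by split; rewrite /f ?doubleS; lia.
have I0 : I 0%N ([::], (Q, [::])) by [].
apply: (ev_let (u := encSt (run gE Q))).
  apply: (ev_fold (encX := @enc_request R n) (encY := @encSt R n) (I := I) (f := f)
    (y := ([::], (Q, [::]))) _ szQ) => // i q st lt Ist.
  split; last exact: stepI.
  have [h1 _] := Ist; have [h3 _] := astep_size gE st.
  apply: (ev_let (u := encSt (astep gE st))).
    by apply: (ev_astep (st := st)) => //; lia.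
  by apply: (ev_astep (st := astep gE st)) => //; lia.
have [_ szo] : I (size Q) (run gE Q) by apply: foldl_inv.
have -> : enc_output (transmissions G Q) =
    enc_list (map (@encT R n) (rev (run gE Q).2.2)) by [].
by apply: (ev_rev (encX := @encT R n)); rewrite // -muln2 mulnC in szo *; lia.
Qed.

End MainProgram.

Lemma steiner_algorithm_polytime (R : realType) : polytime (@steiner_algorithm R).
Proof.
have [p Ep] := tbound_poly (('X + 1) ^+ 2) t_main.
exists (compile t_main), p => n G Q _.
(* Large enough for all lists involved: at most [n ^ 2] edges and [2 * size Q] transmissions. *)
set B := ((n + size Q).+1 ^ 2)%N.
have EB : (('X + 1) ^+ 2 : {poly nat}).[(n + size Q)%N] = B.
  by rewrite horner_exp hornerD hornerX hornerC natrDE natrXE addn1.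
have [|||T le H] := compile_computes (isT : wf t_main) (@ev_main R n B G Q _ _ _).
- by rewrite expn_gt0.
- by rewrite leq_exp2r // leqW // leq_addr.
- by rewrite /B; nia.
by exists T, (transmissions G Q); rewrite -Ep EB.
Qed.

(** * Logarithmic growth of the ratio *)

Local Open Scope classical_set_scope.
Lemma ratio_bigO (R : realType) :
  (ratio R : nat -> R^o) =O_\oo (fun n : nat => ln (n%:R : R) : R^o).
Proof.
have ln2 : 0 < ln (2 : R) by apply: ln_gt0; rewrite ltr1n.
(* With [u] for [up_log 2 k], the ratio is [18 (u - 1) + 63]; both [(u - 1) ln 2] and [ln 2] are at
   most [ln k], and [18 + 63 = 81]. *)
apply/eqO_exP; exists (81 / ln 2); first by rewrite divr_gt0.
exists 2%N => // k /= k2; rewrite /ratio.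
have lnk : ln 2 <= ln (k%:R : R) by rewrite ler_ln ?posrE ?ltr0n ?ler_nat //; exact: ltnW.
rewrite !ger0_norm ?ler0n //; last exact: le_trans (ltW ln2) lnk.
rewrite mulrAC ler_pdivlMr //.
have H : ((up_log 2 k).-1%:R : R) * ln 2 <= ln k%:R.
  have := up_log_gtn (isT : 1 < 2)%N k2 => /ltnW.
  rewrite -(ler_nat R) natrX => le.
  have : ln ((2 : R) ^+ (up_log 2 k).-1) <= ln k%:R.
    by rewrite ler_ln ?posrE ?exprn_gt0 ?ltr0n // ltnW.
  by rewrite lnXn ?ltr0n // => h; rewrite mulr_natl.
have u0 : (0 < up_log 2 k)%N by rewrite up_log_gt0.
have -> : (9 * (up_log 2 k).*2 + 45)%:R = 18 * (up_log 2 k).-1%:R + 63 :> R.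
  have : (up_log 2 k)%:R = (up_log 2 k).-1%:R + 1 :> R by rewrite natr1 prednK.
  rewrite -muln2 natrD !natrM.
  by move: ((up_log 2 k)%:R) ((up_log 2 k).-1%:R) => c d ->; lra.
rewrite mulrDl -mulrA; move: (_ * ln 2) H => c H; lra.
Qed.

Theorem theorem3p1 (R : realType) :
  exists (A : algorithm R) (alpha : nat -> R^o),
    [/\ online A,
        alpha =O_\oo (fun n : nat => ln (n%:R : R) : R^o),
        competitive A alpha
      & polytime A].
Proof.
exists (@steiner_algorithm R), (ratio R); split.
- exact: steiner_algorithm_online.
- exact: ratio_bigO.
- by move=> n G Q vQ; apply: transmissions_competitive.
- exact: steiner_algorithm_polytime.
Qed.
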